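(* Let $n\in\mathbb{N}$ and $s\in[0,\infty)$, and let $\mathring{T}_n^{w_{s+1}}$ denote any minimiser of the restricted problem with parameter $s+1$, i.e. any polynomial $\prod_{k=1}^n(z-e^{i\alpha_k^*})$ with $\alpha_1^*,\dots,\alpha_n^*\in[0,2\pi)$ such that $$\max_{z\in\mathbb{T}}\left|(z-1)^{s+1}\prod_{k=1}^n(z-e^{i\alpha_k^*})\right|=\min_{\alpha_1,\dots,\alpha_n\in[0,2\pi)}\max_{z\in\mathbb{T}}\left|(z-1)^{s+1}\prod_{k=1}^n(z-e^{i\alpha_k})\right|.$$ Then $$\frac{1}{s+n+1}\frac{d}{dz}\left\{w_{s+1}(z)\mathring{T}_n^{w_{s+1}}(z)\right\}=w_s(z)T_n^{w_s}(z)$$ and $$\|w_sT_n^{w_s}\|_{\mathbb{T}}=\frac12\|w_{s+1}\mathring{T}_n^{w_{s+1}}\|_{\mathbb{T}}.$$ Consequently, for every $s\in[1,\infty)$ and $n\in\mathbb{N}$, the minimiser $\mathring{T}_n^{w_s}$ of the restricted problem with parameter $s$ (the problem displayed above with exponent $s$ in place of $s+1$) is unique as a polynomial.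
   Context: $\mathbb{D}$ is the open unit disk, $\mathbb{T}$ the unit circle, $\mathbb{N}$ the positive integers, and $\|g\|_{\mathbb{T}}=\sup_{z\in\mathbb{T}}|g(z)|$. For $s\ge 0$, $w_s(z)=(z-1)^s$ on $\overline{\mathbb{D}}$: fix one analytic branch of $\log(z-1)$ on $\mathbb{D}$ (the same for all $s$), put $w_s(z)=\exp(s\log(z-1))$ on $\mathbb{D}$ and extend continuously to $\overline{\mathbb{D}}$ (so $w_0\equiv1$, $w_s(1)=0$ for $s>0$, and $w_{s+1}(z)=(z-1)w_s(z)$). The first displayed identity of the conclusion is an identity of analytic functions on $\mathbb{D}$ (both sides extend continuously to $\overline{\mathbb{D}}$). $T_n^{w_s}$ denotes the weighted Chebyshev polynomial of degree $n$ for the weight $|w_s|$ on $\mathbb{T}$: the unique monic polynomial of degree $n$ with complex coefficients such that $\|w_sT_n^{w_s}\|_{\mathbb{T}}=\min_{a_1,\dots,a_n\in\mathbb{C}}\max_{z\in\mathbb{T}}\left|(z-1)^s\prod_{k=1}^n(z-a_k)\right|$. *)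

(* Defs.v *)
From HB Require Import structures.
From mathcomp Require Import all_boot all_order all_algebra.
From mathcomp Require Import complex.
From mathcomp Require Import all_classical all_reals all_analysis.

Set Implicit Arguments.
Unset Strict Implicit.
Unset Printing Implicit Defensive.

Import Order.TTheory GRing.Theory Num.Theory.
Import numFieldNormedType.Exports.

Local Open Scope classical_set_scope.
Local Open Scope ring_scope.
Local Open Scope complex_scope.

(* The topology and norm of R[i] as a normed module over itself, so that
   [derivable f z 1] is complex differentiability. *)
HB.instance Definition _ (R : realType) := NormedModule.copy R[i] R[i]^o.

Section Defs.
Variable R : realType.
Local Notation C := R[i].

Definition unit_disk : set C := [set z | `|z| < 1].
Definition unit_circle : set C := [set z | `|z| = 1].

Definition cexp (z : C) : C :=
  (expR (complex.Re z))%:C * (cos (complex.Im z) +i* sin (complex.Im z)).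

Definition log_branch (L : C -> C) : Prop :=
  forall z, unit_disk z -> derivable L z 1 /\ cexp (L z) = z - 1.

(* The limit from inside the disk is the value cexp (s%:C * L z) itself when z
   is in the disk, and the continuous extension when z is on the circle. *)
Definition weight (L : C -> C) (s : R) (z : C) : C :=
  lim (cexp (s%:C * L x) @[x --> within unit_disk (nbhs z)]).

(* [Normc.normc] is the modulus as an element of R; the generic norm `|z| of
   [z : R[i]] lives in R[i].  The supremum in R is a true one only for functions
   that are bounded on the circle, e.g. products of a weight and a polynomial. *)
Definition circle_norm (g : C -> C) : R :=
  sup [set Normc.normc (g z) | z in unit_circle].

Definition weighted_norm (w : C -> C) (P : {poly C}) : R :=
  circle_norm (fun z => w z * P.[z]).

Definition poly_of_roots (n : nat) (a : 'I_n -> C) : {poly C} :=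
  \prod_(k < n) ('X - (a k)%:P).

Definition is_min (A : set R) (m : R) : Prop := A m /\ lbound A m.

Definition is_chebyshev (w : C -> C) (n : nat) (T : {poly C}) : Prop :=
  [/\ T \is monic, size T = n.+1 &
    is_min [set weighted_norm w (poly_of_roots a) | a in [set: 'I_n -> C]]
      (weighted_norm w T)].

(* Definite description: the default 0, which is never a monic polynomial, is
   returned only if existence or uniqueness fails. *)
Definition chebyshev_poly (w : C -> C) (n : nat) : {poly C} :=
  xget 0 [set T | unique (is_chebyshev w n) T].

Definition circle_poly (n : nat) (alpha : 'I_n -> R) : {poly C} :=
  poly_of_roots (fun k => cexp ('i * (alpha k)%:C)).

Definition angles (n : nat) : set ('I_n -> R) :=
  [set alpha | forall k, 0 <= alpha k < 2 * pi].

Definition restricted_minimiser (w : C -> C) (n : nat) (P : {poly C}) : Prop :=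
  (exists2 alpha, @angles n alpha & P = circle_poly alpha) /\
  is_min [set weighted_norm w (circle_poly alpha) | alpha in @angles n]
    (weighted_norm w P).

End Defs.

(* Main.v *)
(* Put [N = s + n + 1].  If all roots of a monic [P] of degree [n] lie on the circle, then
   [(w_(s+1) P)' = N w_s T_P] for a monic [T_P] of degree [n], and a Bernstein-Lax inequality gives
   [|w_s T_P| <= |w_(s+1) P| / 2] on the circle.  Conversely, a Chebyshev polynomial [T] for [w_s] has
   its roots in the closed disk, so that [z T - c T^*], with [T^*] the reversed conjugate of [T] and [c]
   chosen so that it vanishes at 1, has all its roots on the circle; it is thus [(z - 1) P~] with
   [|w_(s+1) P~| <= 2 |w_s T|].  Hence the restricted minimum is twice the unrestricted one, every
   restricted minimiser [P] has [T_P] minimal, [T_P = T] by uniqueness, and [T_P] determines [P].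

   As [s] need not be an integer, the Bernstein-Lax inequality is not the one for polynomials.  The Cayley
   transform turns it into an inequality between a real polynomial [p] of degree at most [n] and its derivative,
   given [|p| <= M (1 + t^2)^(N/2)].  If it fails at a point, then some
   [f = p - K (1 + t^2)^(N/2) sin (N atan t + c)] with [K > M] has too many sign changes: [f^(n+1)] is,
   up to a constant, [(1 + t^2)^(s/2) sin (s atan t + c')], whose phase ranges over an interval of
   length [s pi], and each differentiation loses at most one sign change. *)
Require Import Defs.
From HB Require Import structures.
From mathcomp Require Import all_boot all_order all_algebra.
From mathcomp Require Import complex.
From mathcomp Require Import all_classical all_reals all_analysis.
From mathcomp Require Import ring lra.

Set Implicit Arguments.
Unset Strict Implicit.
Unset Printing Implicit Defensive.

Import Order.TTheory GRing.Theory Num.Theory.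
Import numFieldNormedType.Exports.

Local Open Scope classical_set_scope.
Local Open Scope ring_scope.
Local Open Scope complex_scope.

(** * A Bernstein inequality on the real line *)

Section Wave.
Variable R : realType.
Implicit Types (a c t x y : R) (p : {poly R}) (f g : R -> R).

(** This is the imaginary part of [e^(i c) (1 + i t)^a], since [1 + i t] has modulus
    [(1 + t^2)^(1/2)] and argument [atan t]. *)
Definition wave a c t : R := (1 + t ^+ 2) `^ (a / 2) * sin (a * atan t + c).

Lemma sqrD1_gt0 t : 0 < 1 + t ^+ 2.
Proof. by rewrite ltr_pwDl// sqr_ge0. Qed.

Lemma cos_atan_powR t : cos (atan t) = (1 + t ^+ 2) `^ (- 2^-1).
Proof. by rewrite cos_atan powRN powR12_sqrt// ltW// sqrD1_gt0. Qed.

Lemma sin_atan t : sin (atan t) = t * (1 + t ^+ 2) `^ (- 2^-1).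
Proof.
rewrite -cos_atan_powR -{2}(atanK t) /tan divfK// gt_eqF// cos_gt0_pihalf//.
by rewrite atan_gtNpi2 atan_ltpi2.
Qed.

(** Differentiating [e^(i c) (1 + i t)^a] brings out [i a] and lowers the exponent by one; the
    factor [i] shifts the phase by [pi / 2]. *)
Lemma is_derive_wave a c t :
  is_derive t 1 (wave a c) (a * wave (a - 1) (c + pi / 2) t).
Proof.
have r0 := sqrD1_gt0 t.
have d1 : is_derive t 1 (fun u : R => 1 + u ^+ 2) (2 * t).
  apply: trigger_derive; rewrite /GRing.scale/=; ring.
have d2 : is_derive t 1 (fun u : R => (1 + u ^+ 2) `^ (a / 2))
   (a / 2 * (1 + t ^+ 2) `^ (a / 2 - 1) * (2 * t)).
  exact: (@is_derive1_comp _ (fun x => x `^ (a / 2)) (fun u => 1 + u ^+ 2) t _ _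
    (is_derive1_powR (a / 2) r0) d1).
have d3 : is_derive t 1 (fun u => a * atan u + c) (a * (1 + t ^+ 2)^-1).
  by apply: trigger_derive; rewrite /GRing.scale/=; ring.
have d4 : is_derive t 1 (fun u => sin (a * atan u + c))
    (cos (a * atan t + c) * (a * (1 + t ^+ 2)^-1)).
  exact: (@is_derive1_comp _ sin (fun u => a * atan u + c) t _ _ (is_derive_sin _) d3).
have -> : wave a c = (fun u : R => (1 + u ^+ 2) `^ (a / 2)) * (fun u => sin (a * atan u + c)) by [].
apply: is_derive_eq; rewrite /GRing.scale/= /wave addrA sinDpihalf.
have -> : (a - 1) * atan t + c = (a * atan t + c) - atan t by ring.
rewrite cosB cos_atan_powR sin_atan.
have -> : (1 + t ^+ 2)^-1 = (1 + t ^+ 2) `^ (-1) by rewrite powR_inv1// ltW.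
have -> : (1 + t ^+ 2) `^ (a / 2) * (cos (a * atan t + c) * (a * (1 + t ^+ 2) `^ (-1)))
  = ((1 + t ^+ 2) `^ (a / 2 - 1)) * (cos (a * atan t + c) * a).
  by rewrite powRD ?(gt_eqF r0) ?implybT//; ring.
have -> : a / 2 - 1 = (a - 1) / 2 - 2^-1 by field.
rewrite powRD ?(gt_eqF r0) ?implybT//; last by field.
Qed.

(* [sorted (alternating f) s]: along the list [s], [f] takes nonzero values of alternating signs. *)
Definition alternating f : rel R := fun x y => (x < y) && (f x * f y < 0).

(** Between two consecutive points, the mean value theorem gives a point where [g] has the sign of
    [f] at the right one; these signs alternate in turn. *)
Lemma alternating_deriv f g : (forall x, is_derive x 1 f (g x)) ->
  forall s, sorted (alternating f) s ->
  exists2 s', size s' = (size s).-1 & sorted (alternating g) s'.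
Proof.
move=> fg.
have step x y : x < y -> exists2 z, x < z < y & f y - f x = g z * (y - x).
  move=> xy; have [|z] := @MVT _ f g x y xy (fun u _ => fg u).
    apply: derivable_within_continuous => u _; exact: ex_derive.
  by rewrite in_itv/=; exists z.
case=> [|x [|y s]]; [by exists [::]|by exists [::]|].
rewrite [sorted _ _]/= -[path _ y s]/(sorted (alternating f) (y :: s)).
(* The induction also records where the first new point lies and the sign of [g] there, so that a
   further point can be put before it. *)
suff: forall x y s, alternating f x y -> path (alternating f) y s ->
  exists z s', [/\ x < z < y, 0 < g z * f y, size s' = size s & path (alternating g) z s'].
  move=> H /andP[/H H1 /H1[z [s' [_ _ s's ?]]]].
  by exists (z :: s') => //=; rewrite s's.
have step1 u v : alternating f u v -> exists2 z, u < z < v & 0 < g z * f v.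
  move=> /andP[uv fuv]; have [z zuv e] := step _ _ uv; exists z => //.
  have: 0 < (f v - f u) * f v * (v - u).
    by rewrite mulr_gt0 ?subr_gt0// mulrBl subr_gt0 (lt_le_trans fuv)// -expr2 sqr_ge0.
  rewrite e [X in 0 < X -> _](_ : _ = (g z * f v) * (v - u) ^+ 2); last by ring.
  by rewrite pmulr_lgt0// exprn_gt0// subr_gt0.
move=> {x y s} x y s; elim: s x y => [|w s IH] x y xy.
  by move=> _; have [z zxy gz] := step1 _ _ xy; exists z, [::].
rewrite /= => /andP[yw pw].
have [z2 [s' [z2w gz2 ss' ps']]] := IH _ _ yw pw.
have [z /andP[xz zy] gz] := step1 _ _ xy; exists z, (z2 :: s'); split=> //=.
- by rewrite xz zy.
- by rewrite ss'.
rewrite ps' andbT /alternating (lt_trans zy) ?(andP z2w).1//=; case/andP: yw => _ fyw.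
have : 0 < (g z * g z2) * (f y * f w) by rewrite mulrACA mulr_gt0.
by rewrite nmulr_lgt0.
Qed.

(** Removing [floor (x / pi)] half-turns, each of which changes the sign, brings the angle into
    [[0, pi]]. *)
Lemma sin_floor_sign x : 0 <= (-1) ^ Num.floor (x / pi) * sin x.
Proof.
set k := Num.floor (x / pi).
have /andP[kx xk] := floor_itv (x / pi).
have -> : sin x = (-1) ^ k * sin (x - k%:~R * pi).
  have sinz (m : int) y : sin (y - m%:~R * pi) = (-1) ^ m * sin y.
    case: m => m; rewrite ?NegzE ?mulrNz ?mulNr ?opprK.
      elim: m => [|m IH]; first by rewrite mul0r subr0 expr0z mul1r.
      rewrite exprSz -mulrA -IH -[in RHS](subrK pi (y - _)) sinDpi mulN1r opprK.
      by congr sin; rewrite -addn1 PoszD rmorphD/=; ring.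
    elim: m => [|m IH]; first by rewrite mul1r sinDpi exprN1 invrN1 mulN1r.
    rewrite -addn1 PoszD opprD expfzDr ?oppr_eq0 ?oner_eq0// mulrAC -IH exprN1 invrN1 mulrN1 -sinDpi.
    by congr sin; rewrite rmorphD/=; ring.
  by rewrite sinz mulrA -expfzMl mulrNN mulr1 exp1rz mul1r.
rewrite mulrA -expfzMl mulrNN mulr1 exp1rz mul1r sin_ge0_pi//.
rewrite subr_ge0 -ler_pdivlMr ?pi_gt0// kx/= lerBlDr -[X in X + _]mul1r -mulrDl addrC.
by rewrite -ler_pdivrMr ?pi_gt0// (le_trans (ltW xk))// rmorphD/= lexx.
Qed.

Lemma sin_change_floor x y : x <= y -> sin x * sin y < 0 ->
  (Num.floor (x / pi) + 1 <= Num.floor (y / pi))%R.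
Proof.
move=> xy sxy; have le : (Num.floor (x / pi) <= Num.floor (y / pi))%R.
  by apply: le_floor; rewrite ler_pM2r// invr_gt0 pi_gt0.
rewrite lezD1 lt_neqAle le andbT; apply/eqP => e.
have := sin_floor_sign x; have := sin_floor_sign y; rewrite e => h1 h2.
have := mulr_ge0 h1 h2; rewrite mulrACA -expfzMl mulrNN mulr1 exp1rz mul1r.
by rewrite mulrC leNgt sxy.
Qed.

(** Each sign change raises the floor of the phase over [pi], and this quotient varies by at most
    [a]. So there are fewer than [a + 1] changes, and one more point than changes. *)
Lemma alternating_wave_size (K : R) a c s : 0 <= a ->
  sorted (alternating (fun t => K * wave a c t)) s -> (size s)%:R < a + 2.
Proof.
move=> a0; case: s => [|x s]; first by move=> _; rewrite ltr_wpDl.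
move=> /= ps; pose ph t := a * atan t + c.
suff h : Num.floor (ph x / pi) + (size s)%:Z <= Num.floor (ph (last x s) / pi).
  have /andP[_ h1] := floor_itv (ph x / pi).
  have /andP[h2 _] := floor_itv (ph (last x s) / pi).
  have {}h : (Num.floor (ph x / pi))%:~R + (size s)%:R <= (Num.floor (ph (last x s) / pi))%:~R :> R.
    by rewrite pmulrn -intrD ler_int.
  have : (size s)%:R < 1 + (ph (last x s) / pi - ph x / pi).
    move: h1; rewrite rmorphD/= => h1; lra.
  rewrite -mulrBl opprD addrACA subrr addr0 -mulrBr => h3.
  have : a * (atan (last x s) - atan x) / pi <= a.
    rewrite ler_pdivrMr ?pi_gt0// ler_wpM2l//.
    have := atan_ltpi2 (last x s); have := atan_gtNpi2 x; lra.
  by rewrite -addn1 natrD; lra.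
elim: s x ps => [|y s IH] x /=; first by rewrite addr0.
move=> /andP[/andP[xy sxy] /IH]; apply: le_trans; rewrite -add1n PoszD addrA lerD2r.
apply: sin_change_floor; first by rewrite lerD2r ler_wpM2l// le_atan// ltW.
have := sxy; rewrite /wave !(mulrA K) mulrACA pmulr_rlt0//.
rewrite mulrACA; apply: mulr_gt0; last by rewrite mulr_gt0 ?powR_gt0 ?sqrD1_gt0.
rewrite -[_ * _]/(K ^+ 2) lt_neqAle sqr_ge0 eq_sym sqrf_eq0 andbT.
by apply: contraTneq sxy => ->; rewrite !mul0r ltxx.
Qed.

(* Each of [m] differentiations loses at most one point, kills one degree of [p] and turns
   [wave a c] into a multiple of [wave (a - 1) (c + pi / 2)]. *)
Lemma alternating_poly_wave_size m (K : R) a c p s : (size p <= m)%N -> 0 <= a ->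
  sorted (alternating (fun t => p.[t] - K * wave (m%:R + a) c t)) s ->
  (size s)%:R < m%:R + a + 2.
Proof.
move=> + a0; elim: m K c p s => [|m IH] K c p s.
  rewrite leqn0 size_poly_eq0 => /eqP -> ps; rewrite add0r.
  apply: (@alternating_wave_size (- K) a c) => //; congr (is_true (sorted (alternating _) _)): ps.
  by apply/funext => t; rewrite horner0 !add0r mulNr.
move=> sp ps; have [t|s' ss' ps'] := @alternating_deriv _
  (fun t => p^`().[t] - (K * (m.+1%:R + a)) * wave (m%:R + a) (c + pi / 2) t) _ _ ps.
  have -> : m%:R + a = m.+1%:R + a - 1 by rewrite -addn1 natrD; ring.
  have dw := is_derive_wave (m.+1%:R + a) c t.
  apply: is_deriveB; rewrite -mulrA; exact: (is_deriveZ _ dw).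
have := IH _ _ _ _ _ ps'; rewrite ss'.
have -> : (size p^`() <= m)%N.
  by have := lt_size_deriv; case: (eqVneq p 0) => [->|p0] H; rewrite ?deriv0 ?size_poly0// -ltnS (leq_trans (H _ _ p0)).
move=> /(_ isT); rewrite -!natr1; case: (size s) => [|k]/=; rewrite ?mulr0n; last by rewrite -!natr1; lra.
have := ler0n R m; lra.
Qed.

Lemma alternatingN f : alternating (fun t => - f t) = alternating f.
Proof. by apply/funext => x; apply/funext => y; rewrite /alternating mulrNN. Qed.

(** The polynomial is [O(|t|^n)], while the right-hand side is at least [e |t|^(n + 1)]. *)
Lemma poly_lt_powR p n a (e : R) : (size p <= n.+1)%N -> n%:R + 1 <= a -> 0 < e ->
  \forall t \near -oo, `|p.[t]| < e * (1 + t ^+ 2) `^ (a / 2).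
Proof.
move=> sp na e0; pose C : R := \sum_(i < size p) `|p`_i|.
have C0 : 0 <= C by rewrite sumr_ge0.
near=> t.
have t1 : 1 <= `|t|.
  by rewrite ler_normr lerNr; apply/orP; right; near: t; by apply: nbhs_ninfty_le; rewrite num_real.
have tC : C / e < `|t|.
  by rewrite ltr_normr ltrNr; apply/orP; right; near: t; by apply: nbhs_ninfty_lt; rewrite num_real.
have h1 : `|p.[t]| <= C * `|t| ^+ n.
  rewrite horner_coef (le_trans (ler_norm_sum _ _ _))// mulr_suml ler_sum// => i _.
  by rewrite normrM ler_wpM2l// normrX ler_weXn2l// -ltnS (leq_trans _ sp).
have h2 : `|t| ^+ n.+1 <= (1 + t ^+ 2) `^ (a / 2).
  have -> : `|t| ^+ n.+1 = (t ^+ 2) `^ (n.+1%:R / 2).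
    by rewrite -(real_normK (num_real t)) -!powR_mulrn// -powRrM; congr (_ `^ _); field.
  apply: (@le_trans _ _ ((1 + t ^+ 2) `^ (n.+1%:R / 2))).
    by rewrite ge0_ler_powR ?nnegrE ?divr_ge0 ?sqr_ge0 ?lerDr ?ltW ?sqrD1_gt0.
  by rewrite ler_powR ?lerDl ?sqr_ge0// ler_pM2r ?invr_gt0// -natr1.
apply: (le_lt_trans h1); apply: (@lt_le_trans _ _ (e * `|t| ^+ n.+1)).
  by rewrite exprS mulrA ltr_pM2r ?exprn_gt0 ?(lt_le_trans _ t1)// -ltr_pdivrMl// mulrC.
by rewrite ler_pM2l.
Unshelve. all: by end_near. Qed.

Lemma cvgNy_atan : atan x @[x --> -oo] --> (- (pi / 2) : R).
Proof.
apply/cvgNy_compNP; have -> : (@atan R) \o -%R = - (@atan R).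
  by apply/funext => x /=; rewrite atanN.
by apply: cvgN; exact: cvgy_atan.
Qed.

(* On the left of [x], [p - K wave] has the sign of [- wave] at the points where the phase of [wave] is
   an odd multiple of [pi / 2], and also near [-oo] when the limit of the phase is not a multiple of [pi].
   The induction replaces [(p, c)] by [(- p, c + pi)], which only changes the sign of the function. *)
Lemma alternating_extend_left (M K a : R) n d : M < K -> n%:R + 1 <= a ->
  forall p c x s, (size p <= n.+1)%N ->
  (forall t, `|p.[t]| <= M * (1 + t ^+ 2) `^ (a / 2)) ->
  p.[x] - K * wave a c x < 0 -> - (pi / 2) < a * atan x + c ->
  (d = 0)%N \/ c - a * (pi / 2) < - (d.-1%:R * pi) ->
  sorted (alternating (fun t => p.[t] - K * wave a c t)) (x :: s) ->
  exists2 s', size s' = d & sorted (alternating (fun t => p.[t] - K * wave a c t)) (s' ++ x :: s).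
Proof.
move=> MK na; have a0 : 0 < a by rewrite (lt_le_trans _ na)// ltr_wpDl.
have pi0 := @pi_gt0 R.
elim: d => [|d IH] p c x s sp pM fx phx; first by move=> _; exists [::].
case=> // /= cd xs.
have M0 : 0 <= M.
  by have := pM 0; rewrite expr0n addr0 powR1 mulr1; apply: le_trans; rewrite normr_ge0.
have K0 : 0 < K by rewrite (le_lt_trans M0).
(* The phase tends to [c - a pi / 2] at [-oo]. If this is at least [- pi / 2], the phase [- pi / 2]
   is never reached, and the only point still to be added is found near [-oo]. *)
have [cpi|cpi] := ltP (c - a * (pi / 2)) (- (pi / 2)); last first.
  have d0 : d = 0%N.
    apply/eqP; rewrite -leqn0 leqNgt; apply/negP => d0.
    have : (pi : R) <= d%:R * pi by rewrite ler_peMl ?pi_ge0// ler1n.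
    lra.
  rewrite {}d0 mul0r oppr0 in cd *.
  have sina : sin (c - a * (pi / 2)) < 0.
    by rewrite -[c - _]opprK sinN oppr_lt0 sin_gt0_pi//; lra.
  suff [y yx fy] : exists2 y, y < x & 0 < p.[y] - K * wave a c y.
    by exists [:: y] => //=; rewrite /= in xs; rewrite xs andbT /alternating yx /= nmulr_llt0.
  have : \forall y \near -oo, y < x /\ 0 < p.[y] - K * wave a c y.
    near=> y; split; first by near: y; apply: nbhs_ninfty_lt; rewrite num_real.
    have sy : sin (a * atan y + c) < sin (c - a * (pi / 2)) / 2.
      near: y.
      have cv : sin (a * atan y + c) @[y --> -oo] --> sin (c - a * (pi / 2)).
        apply: continuous_cvg; first exact: continuous_sin.
        by rewrite addrC -mulrN; apply: cvgD; [exact: cvgMl_tmp cvgNy_atan|exact: cvg_cst].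
      move/cvgr_lt : cv; apply; lra.
    have py : `|p.[y]| < K * - (sin (c - a * (pi / 2)) / 2) * (1 + y ^+ 2) `^ (a / 2).
      near: y; apply: poly_lt_powR sp na _; rewrite mulr_gt0//; lra.
    have : K * (1 + y ^+ 2) `^ (a / 2) * sin (a * atan y + c) <
        K * (1 + y ^+ 2) `^ (a / 2) * (sin (c - a * (pi / 2)) / 2).
      by rewrite ltr_pM2l// mulr_gt0// powR_gt0 ?sqrD1_gt0.
    move: py; rewrite ltr_norml => /andP[+ _]; rewrite /wave; lra.
  by move=> /filter_ex[y []]; exists y.
(* Otherwise the new point [y] is the one of phase [- pi / 2], where [- K wave] is positive and
   exceeds [|p|]. *)
have phx2 : (- (pi / 2) - c) / a < pi / 2.
  by rewrite ltr_pdivrMr//; have := atan_ltpi2 x; rewrite -(ltr_pM2r a0); lra.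
have phx1 : - (pi / 2) < (- (pi / 2) - c) / a by rewrite ltr_pdivlMr//; lra.
pose y := tan ((- (pi / 2) - c) / a).
have ay : atan y = (- (pi / 2) - c) / a by rewrite tanK// in_itv/= phx1 phx2.
have phy : a * atan y + c = - (pi / 2) by rewrite ay mulrC divfK ?gt_eqF//; ring.
have yx : y < x.
  rewrite ltNge; apply/negP => /le_atan; rewrite -(ler_pM2l a0); lra.
have fy : 0 < p.[y] - K * wave a c y.
  rewrite /wave phy sinN sin_pihalf mulrN1 mulrN opprK -ltrBlDl sub0r ltrNl.
  have : `|p.[y]| < K * (1 + y ^+ 2) `^ (a / 2).
    by rewrite (le_lt_trans (pM y))// ltr_pM2r// powR_gt0 ?sqrD1_gt0.
  by rewrite ltr_norml => /andP[].
have fE : (fun t => (- p).[t] - K * wave a (c + pi) t) = (fun t => - (p.[t] - K * wave a c t)).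
  by apply/funext => t; rewrite hornerN /wave addrA sinDpi; ring.
have [||||||s' s'd xs'] := IH (- p) (c + pi) y (x :: s).
- by rewrite size_polyN.
- by move=> t; rewrite hornerN normrN.
- by rewrite (congr1 (@^~ y) fE) oppr_lt0.
- by rewrite addrA phy; lra.
- case: (posnP d) => [|d0]; [by left|right].
  by move: cd; rewrite -{1}(prednK d0) -natr1; lra.
- by rewrite fE alternatingN; apply/andP; split; rewrite // /alternating yx nmulr_llt0.
exists (rcons s' y); first by rewrite size_rcons s'd.
by rewrite cat_rcons; move: xs'; rewrite fE alternatingN.
Unshelve. all: by end_near. Qed.

(** Reflection lets [alternating_extend_left] serve on the right as well; the change of sign makes
    the function negative at the new first point when [f] is positive at the last one. *)
Lemma alternating_rev f s : sorted (alternating f) s ->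
  sorted (alternating (fun t => - f (- t))) [seq - t | t <- rev s].
Proof.
rewrite sorted_map rev_sorted; apply: sub_sorted => x y /andP[xy fxy].
by rewrite /alternating/= ltrN2 xy !opprK mulrNN mulrC.
Qed.

Lemma nat_ceil x : exists2 d : nat, x <= d%:R & (d = 0)%N \/ d.-1%:R < x.
Proof.
have [x0|x0] := leP x 0; first by exists 0%N => //; left.
have /andP[] := ceil_itv x; have : 0 < Num.ceil x by rewrite ceil_gt0.
case: (Num.ceil x) => // -[//|d] _ h1 h2; exists d.+1 => //; right.
by move: h1; rewrite -addn1 PoszD addrK addn1.
Qed.

(* If the inequality fails, then [f = p - K wave], for the phase that makes [f] vanish at [x], increases
   through [x] while the wave itself is increasing, hence has two more sign changes than the wave. *)
Lemma bernstein_slope n (M K a : R) p b x : M < K -> n%:R + 1 <= a -> (size p <= n.+1)%N ->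
  (forall t, `|p.[t]| <= M * (1 + t ^+ 2) `^ (a / 2)) ->
  - (pi / 2) < b < pi / 2 -> p.[x] = K * (1 + x ^+ 2) `^ (a / 2) * sin b ->
  (1 + x ^+ 2) * p^`().[x] - a * x * p.[x] <= a * K * (1 + x ^+ 2) `^ (a / 2) * cos b.
Proof.
move=> MK na sp pM /andP[b1 b2] px; rewrite leNgt; apply/negP => slope.
have a0 : 0 < a by rewrite (lt_le_trans _ na)// ltr_wpDl.
have r0 := sqrD1_gt0 x; have pi0 := @pi_gt0 R.
(* This [c] makes the phase at [x] equal to [b], so that [f] vanishes there. *)
pose c := b - a * atan x; pose f t := p.[t] - K * wave a c t.
have phx : a * atan x + c = b by rewrite /c; ring.
have fx : f x = 0 by rewrite /f /wave phx px; ring.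
pose f' := p^`().[x] - K * (a * wave (a - 1) (c + pi / 2) x).
have df : is_derive x 1 f f'.
  have dw := is_derive_wave a c x; apply: is_deriveB; exact: (is_deriveZ _ dw).
have f'0 : 0 < f'.
  rewrite -(pmulr_rgt0 _ r0) /f' /wave addrA sinDpihalf.
  have -> : (a - 1) * atan x + c = b - atan x by rewrite /c; ring.
  rewrite cosB cos_atan_powR sin_atan.
  have e : (1 + x ^+ 2) * ((1 + x ^+ 2) `^ ((a - 1) / 2) * (1 + x ^+ 2) `^ (- 2^-1)) = (1 + x ^+ 2) `^ (a / 2).
    rewrite -{1}[1 + x ^+ 2]powRr1 ?ltW// -!powRD ?(gt_eqF r0) ?implybT//.
    by congr (_ `^ _); field.
  rewrite [X in 0 < X](_ : _ = (1 + x ^+ 2) * p^`().[x] - a * K *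
    ((1 + x ^+ 2) * ((1 + x ^+ 2) `^ ((a - 1) / 2) * (1 + x ^+ 2) `^ (- 2^-1))) * (cos b + x * sin b)); last by ring.
  rewrite e; move: slope; rewrite px; lra.
have [h [h0 hl hr]] : exists h, [/\ 0 < h, f (x - h) < 0 /\ - (pi / 2) < a * atan (x - h) + c
   & 0 < f (x + h) /\ a * atan (x + h) + c < pi / 2].
  have : \forall h \near 0^', 0 < h^-1 *: (f (h *: 1 + x) - f x) /\
      (- (pi / 2) < a * atan (h + x) + c /\ a * atan (h + x) + c < pi / 2).
    have cph : a * atan (h + x) + c @[h --> 0^'] --> b.
      apply: cvg_within_filter; rewrite -phx -{2}(add0r x).
      apply: cvgD; last exact: cvg_cst.
      apply: cvgMl_tmp; apply: continuous_cvg; first exact: continuous_atan.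
      by apply: cvgD; [exact: cvg_id|exact: cvg_cst].
    have [/cvg_ex[l fl] ] := df; rewrite /derive (cvg_lim _ fl)// => lE.
    rewrite {}lE in fl; have n1 := cvgr_gt f' fl _ f'0.
    by apply: filterS3 (n1 _) (cvgr_gt b cph _ b1) (cvgr_lt b cph _ b2) => h h1 h2 h3; split.
  move=> [e /= e0 he]; exists (e / 2).
  have e2 : 0 < e / 2 by rewrite divr_gt0.
  have := he (e / 2); have := he (- (e / 2)).
  rewrite /ball_/= !sub0r !normrN (gtr0_norm e2) ltr_pdivrMr// ltr_pMr// ltr1n fx.
  rewrite oppr_eq0 gt_eqF// !subr0 /GRing.scale/= !mulr1 -![_ + x]addrC invrN mulNr.
  move=> /(_ isT isT)[+ [h1 h2]] /(_ isT isT)[+ [h3 h4]].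
  by rewrite oppr_gt0 !pmulr_rlt0 ?pmulr_rgt0 ?invr_gt0.
have [hl1 hl2] := hl; have [hr1 hr2] := hr.
have s0 : sorted (alternating f) [:: x - h; x + h].
  by rewrite /= andbT /alternating ltrD2l (lt_trans _ h0) ?oppr_lt0//= nmulr_rlt0.
(* The phase runs from [c - a pi / 2] to [c + a pi / 2]. Rounding up the half-turns before and after
   phase 0 gives [d] and, below, [e], so that [d + e >= a]. *)
have [d xd dx] := nat_ceil ((a * (pi / 2) - c) / pi).
have [|s1 s1d s1s] := @alternating_extend_left M K a n d MK na p c (x - h) [:: x + h] sp pM hl1 hl2 _ s0.
  by case: dx => [->|dx]; [left|right; move: dx; rewrite ltr_pdivlMr//; lra].
have := alternating_rev s1s; set g := fun t => - _.
pose q := - (p \Po (- 'X)).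
have gE : g = (fun t => q.[t] - K * wave a (- c) t).
  apply/funext => t; rewrite /g /q /f hornerN horner_comp hornerN hornerX /wave sqrrN atanN.
  have -> : a * - atan t + c = - (a * atan t + - c) by ring.
  by rewrite sinN; ring.
rewrite gE rev_cat map_cat => s2s.
have [e xe ex] := nat_ceil ((a * (pi / 2) + c) / pi).
have [|||||s3 s3e s3s] := @alternating_extend_left M K a n e MK na q (- c) (- (x + h))
  (- (x - h) :: [seq - t | t <- rev s1]) _ _ _ _ _ s2s.
- by rewrite size_polyN size_comp_poly2 ?size_polyN ?size_polyX.
- by move=> t; rewrite /q hornerN normrN horner_comp hornerN hornerX -(sqrrN t).
- by have /(congr1 (@^~ (- (x + h)))) := gE; rewrite /= /g opprK => <-; rewrite oppr_lt0.
- by rewrite atanN; lra.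
- by case: ex => [->|ex]; [left|right; move: ex; rewrite ltr_pdivlMr//; lra].
have na1 : n.+1%:R <= a by rewrite -natr1.
(* The list has [d + e + 2], hence at least [a + 2], points, against the strict bound [a + 2]. *)
have := @alternating_poly_wave_size n.+1 K (a - n.+1%:R) (- c) q
  (s3 ++ [:: - (x + h), - (x - h) & [seq - t | t <- rev s1]]).
rewrite subr_ge0 na1 addrC subrK => /(_ _ isT s3s).
rewrite size_cat s3e /= size_map size_rev s1d; rewrite size_polyN size_comp_poly2 ?size_polyN ?size_polyX// => /(_ sp).
rewrite natrD -addn2 natrD; move: xd xe; rewrite !ler_pdivrMr// => xd xe.
have h1 : a * pi <= (d%:R + e%:R) * pi by lra.
by rewrite ler_pM2r// in h1; lra.
Qed.

(** With [r = 1 + x^2], the slope bounds for [p] and [- p] give [(r p' - a x p)^2 <= (a K r^(a/2)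
    cos b)^2]. Adding [a^2 p^2] to both sides eliminates [b] and makes the left side [r] times that
    of the claim. *)
Lemma bernstein_halfplane n (M a : R) p x : n%:R + 1 <= a -> (size p <= n.+1)%N ->
  (forall t, `|p.[t]| <= M * (1 + t ^+ 2) `^ (a / 2)) ->
  (a * p.[x] - x * p^`().[x]) ^+ 2 + p^`().[x] ^+ 2 <= a ^+ 2 * M ^+ 2 * (1 + x ^+ 2) `^ (a - 1).
Proof.
move=> na sp pM; pose r := 1 + x ^+ 2.
pose W := (a * p.[x] - x * p^`().[x]) ^+ 2 + p^`().[x] ^+ 2.
rewrite -/r -/W leNgt; apply/negP => viol.
have a0 : 0 < a by rewrite (lt_le_trans _ na)// ltr_wpDl.
have r0 : 0 < r := sqrD1_gt0 x.
have M0 : 0 <= M.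
  by have := pM 0; rewrite expr0n addr0 powR1 mulr1; apply: le_trans; rewrite normr_ge0.
pose V := W / (a ^+ 2 * r `^ (a - 1)).
have ra0 : 0 < a ^+ 2 * r `^ (a - 1) by rewrite mulr_gt0 ?exprn_gt0 ?powR_gt0.
have MV : M ^+ 2 < V by rewrite ltr_pdivlMr// mulrA [M ^+ 2 * _]mulrC.
(* Equality would hold with [V] in place of [M^2]. Taking [K^2] halfway between them gives [K > M],
   and the bound with [K] still fails. *)
pose K := Num.sqrt ((M ^+ 2 + V) / 2).
have MV0 : 0 <= (M ^+ 2 + V) / 2 by have := sqr_ge0 M; lra.
have K2 : K ^+ 2 = (M ^+ 2 + V) / 2 by rewrite sqr_sqrtr.
have MK : M < K by rewrite -(@ltr_pXn2r _ 2) ?nnegrE ?sqrtr_ge0// K2; lra.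
have K0 : 0 < K by exact: le_lt_trans MK.
have rp0 : 0 < r `^ (a / 2) by rewrite powR_gt0.
have Kr0 : 0 < K * r `^ (a / 2) by rewrite mulr_gt0.
pose u := p.[x] / (K * r `^ (a / 2)).
have : `|u| < 1.
  by rewrite normrM normfV (gtr0_norm Kr0) ltr_pdivrMr// mul1r (le_lt_trans (pM x))// ltr_pM2r.
rewrite ltr_norml => /andP[u1 u2]; pose b := asin u.
have b1 : - (pi / 2) < b by rewrite asin_gtNpi2// u1 ltW.
have b2 : b < pi / 2 by rewrite asin_ltpi2// u2 ltW.
have sinb : sin b = u by rewrite asinK// in_itv/= !ltW.
have px : p.[x] = K * r `^ (a / 2) * sin b by rewrite sinb mulrC divfK// gt_eqF.
have h1 := @bernstein_slope n M K a p b x MK na sp pM _ px.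
have h2 := @bernstein_slope n M K a (- p) (- b) x MK na _ _ _ _.
move: h1 h2; rewrite b1 b2 ltrN2 ltrNl b1 b2 size_polyN sp cosN sinN derivN !hornerN.
move=> /(_ isT) h1 /(_ isT) h2.
have {}h2 := h2 (fun t => ltac:(by rewrite hornerN normrN)) isT ltac:(by rewrite px mulrN).
rewrite -/r in h1 h2.
have h3 : (r * p^`().[x] - a * x * p.[x]) ^+ 2 <= (a * K * r `^ (a / 2) * cos b) ^+ 2.
  by rewrite -subr_ge0 subr_sqr mulr_ge0//; lra.
have ra : r `^ (a / 2) ^+ 2 = r * r `^ (a - 1).
  by rewrite mulr_powRB1 ?ltW// -powR_mulrn ?ltW// -powRrM divfK.
have h4 : (a * K * r `^ (a / 2) * cos b) ^+ 2 = r * (a ^+ 2 * K ^+ 2 * r `^ (a - 1)) - a ^+ 2 * p.[x] ^+ 2.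
  rewrite px !exprMn cos2sin2 ra; ring.
have : r * W <= r * (a ^+ 2 * K ^+ 2 * r `^ (a - 1)).
  rewrite -(lerD2r (- (a ^+ 2 * p.[x] ^+ 2))) -h4; apply: le_trans h3.
  by rewrite le_eqVlt; apply/orP; left; apply/eqP; rewrite /W /r; ring.
rewrite ler_pM2l// K2 leNgt => /negP; apply.
have : (M ^+ 2 + V) / 2 < V by lra.
rewrite -(ltr_pM2r ra0) /V divfK ?gt_eqF// -/W; congr (is_true (_ < _)); ring.
Qed.

End Wave.

(** * Topology of the complex plane *)

Section ComplexTopology.
Variable R : realType.
Local Notation C := R[i].
Local Notation normc := Normc.normc.
Implicit Types (z w : C) (x y : R).

Lemma normCE z : `|z| = (normc z)%:C.
Proof. by []. Qed.

Lemma normc_ge0 z : 0 <= normc z.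
Proof. by case: z => a b; exact: sqrtr_ge0. Qed.

Lemma normc_eq0 z : (normc z == 0) = (z == 0).
Proof. by rewrite -(inj_eq (@complexI _)) -normCE normr_eq0. Qed.

Lemma normcR x : normc x%:C = `|x|.
Proof. by rewrite /= expr0n addr0 sqrtr_sqr. Qed.

Lemma normc_sqr z : normc z ^+ 2 = complex.Re z ^+ 2 + complex.Im z ^+ 2.
Proof. by case: z => a b; rewrite /= sqr_sqrtr// addr_ge0 ?sqr_ge0. Qed.

Lemma normc_conj z : normc z^*%C = normc z.
Proof. by apply: (@complexI R); rewrite -!normCE normcJ. Qed.

Lemma abs_Re_le z : `|complex.Re z| <= normc z.
Proof. by rewrite -lecR -normCE; exact: normc_ge_Re. Qed.

Lemma abs_Im_le z : `|complex.Im z| <= normc z.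
Proof.
rewrite -(@ler_pXn2r _ 2) ?nnegrE ?normc_ge0// normc_sqr real_normK ?num_real//.
by rewrite lerDr sqr_ge0.
Qed.

Lemma normc_le z : normc z <= `|complex.Re z| + `|complex.Im z|.
Proof.
rewrite -(@ler_pXn2r _ 2) ?nnegrE ?normc_ge0 ?addr_ge0// normc_sqr sqrrD !real_normK ?num_real//.
by rewrite lerD2r lerDl mulrn_wge0// mulr_ge0.
Qed.

Lemma gtc0_Re (e : C) : 0 < e -> exists2 r : R, 0 < r & e = r%:C.
Proof. by case: e => a b; rewrite ltcE/= => /andP[/eqP -> a0]; exists a. Qed.

(** A positive element of [R[i]] is real, so that balls with radius in [R[i]] are balls for the
    real-valued modulus. *)
Lemma nbhs_normcP z (P : set C) :
  nbhs z P <-> exists2 e : R, 0 < e & forall w, normc (z - w) < e -> P w.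
Proof.
split=> [/nbhs_ballP[e /= /gtc0_Re[r r0 ->] h]|[e e0 h]].
  by exists r => // w zw; apply: h; rewrite -ball_normE/= normCE ltcR.
apply/nbhs_ballP; exists e%:C; first by rewrite /= ltcR.
by move=> w; rewrite -ball_normE/= normCE ltcR => /h.
Qed.

Lemma cvg_normcP (T : Type) (F : set_system T) (FF : Filter F) (f : T -> C) z :
  f @ F --> z <-> forall e : R, 0 < e -> \forall t \near F, normc (z - f t) < e.
Proof.
split=> [fz e e0|h P /nbhs_normcP[e e0 eP]].
  have /fz : nbhs z [set w | normc (z - w) < e] by apply/nbhs_normcP; exists e.
  by [].
by have := h _ e0; apply: filterS => t; exact: eP.
Qed.

Lemma continuous_Re : continuous (@complex.Re R : C -> R).
Proof.
move=> z; apply/(@cvgrPdist_lt _ _ _ (nbhs z)) => e e0; apply/nbhs_normcP; exists e => // w.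
by apply: le_lt_trans; rewrite -raddfB; exact: abs_Re_le.
Qed.

Lemma continuous_Im : continuous (@complex.Im R : C -> R).
Proof.
move=> z; apply/(@cvgrPdist_lt _ _ _ (nbhs z)) => e e0; apply/nbhs_normcP; exists e => // w.
by apply: le_lt_trans; rewrite -raddfB; exact: abs_Im_le.
Qed.

Lemma continuous_normc : continuous (@normc R : C -> R).
Proof.
move=> z; apply/(@cvgrPdist_lt _ _ _ (nbhs z)) => e e0; apply/nbhs_normcP; exists e => // w.
apply: le_lt_trans; have h1 := le_normcD (z - w) w; have h2 := le_normcD (w - z) z.
rewrite !subrK -(normcN (w - z)) opprB in h1 h2.
by rewrite ler_norml; apply/andP; split; lra.
Qed.

Lemma continuous_real_complex : continuous (fun x : R => x%:C : C).
Proof.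
move=> x; apply/cvg_normcP => e e0; near=> y; rewrite -raddfB normcR; near: y.
by apply: cvgr_dist_lt => //; exact: cvg_id.
Unshelve. all: by end_near. Qed.

Lemma cvg_complex (T : Type) (F : set_system T) (FF : Filter F) (f g : T -> R) x y :
  f @ F --> x -> g @ F --> y -> (f t +i* g t) @[t --> F] --> (x +i* y).
Proof.
move=> fx gy; apply/cvg_normcP => e e0; near=> t.
rewrite (le_lt_trans (normc_le _))// [e]splitr ltrD//=; near: t; apply: cvgr_dist_lt => //; lra.
Unshelve. all: by end_near. Qed.

(** * The complex exponential and complex derivatives *)

Lemma cexp0 : cexp 0 = 1 :> C.
Proof. by rewrite /cexp /= expR0 cos0 sin0 mul1r. Qed.

Lemma cexpD z w : cexp (z + w) = cexp z * cexp w.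
Proof.
rewrite /cexp !raddfD/= expRD rmorphM/= mulrACA; congr (_ * _).
by rewrite cosD sinD; apply/eqP; rewrite eq_complex/=; apply/andP; split; apply/eqP; ring.
Qed.

Lemma normc_cexp z : normc (cexp z) = expR (complex.Re z).
Proof. by rewrite Normc.normcM normcR ger0_norm ?expR_ge0//= cos2Dsin2 sqrtr1 mulr1. Qed.

Lemma cexp_neq0 z : cexp z != 0.
Proof. by rewrite -normc_eq0 normc_cexp gt_eqF// expR_gt0. Qed.

(** An expansion without quotient holds at [h = 0] too, and can thus be applied to real and
    imaginary parts, which may vanish. *)
Lemma is_derive_near (f : R -> R) (a d : R) : is_derive a 1 f d ->
  forall e, 0 < e -> \forall h \near nbhs (0 : R), `|f (h + a) - f a - d * h| <= e * `|h|.
Proof.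
move=> df e e0; have [/cvg_ex[l fl] ] := df; rewrite /derive (cvg_lim _ fl)// => lE.
rewrite {l}lE in fl; have := @cvgr_dist_lt _ _ _ _ _ _ _ fl e e0.
move=> [r /= r0 hr]; exists r => //= h /hr /= H.
have [->|h0] := eqVneq h 0; first by rewrite add0r subrr mulr0 subr0 !normr0 mulr0.
have -> : f (h + a) - f a - d * h = - h * (d - h^-1 *: ((f \o shift a) h%:A - f a)).
  by rewrite /= /GRing.scale/= mulr1; field.
by rewrite normrM normrN mulrC ler_wpM2r// ltW// H.
Qed.

Lemma cvg_is_derive (K : numFieldType) (f : K -> K) (a d : K) :
  h^-1 *: (f (h *: 1 + a) - f a) @[h --> 0^'] --> d -> is_derive a 1 f d.
Proof.
by move=> fd; split; [apply/cvg_ex; exists d|apply: cvg_lim].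
Qed.

(** By [cexpD] only the difference quotient at 0 matters; its limit comes from the expansions of
    [expR], [cos] and [sin]. *)
Lemma is_derive_cexp z : is_derive z 1 (@cexp R) (cexp z).
Proof.
apply: cvg_is_derive.
have h : (cexp h - 1) / h @[h --> (0 : C)^'] --> (1 : C).
  apply/cvg_normcP => e e0.
  have Re0 := @continuous_Re (0 : C); have Im0 := @continuous_Im (0 : C).
  (* The errors [k1] to [k4] add up to six times [e / 12], half of what is allowed. *)
  have e12 : 0 < e / 12 by rewrite divr_gt0.
  have n1 : nbhs (0 : C) (fun h => `|expR (complex.Re h + 0) - expR 0 - expR 0 * complex.Re h|
      <= e / 12 * `|complex.Re h|) := Re0 _ (is_derive_near (is_derive_expR 0) e12).
  have n2 : nbhs (0 : C) (fun h => `|cos (complex.Im h + 0) - cos 0 - - sin 0 * complex.Im h|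
      <= e / 12 * `|complex.Im h|) := Im0 _ (is_derive_near (is_derive_cos 0) e12).
  have n3 : nbhs (0 : C) (fun h => `|sin (complex.Im h + 0) - sin 0 - cos 0 * complex.Im h|
      <= e / 12 * `|complex.Im h|) := Im0 _ (is_derive_near (is_derive_sin 0) e12).
  have cexp0 : expR x @[x --> (0 : R)] --> (1 : R) by rewrite -(@expR0 R); exact: continuous_expR.
  have n4 : nbhs (0 : C) (fun h => expR (complex.Re h) < 2).
    apply: (Re0 (fun u => expR u < 2)); by apply: (cvgr_lt _ cexp0); rewrite ltr1n.
  have n5 : nbhs (0 : C) (fun h => `|1 - expR (complex.Re h)| < e / 12).
    apply: (Re0 (fun u => `|1 - expR u| < e / 12)); exact: (@cvgr_dist_lt _ _ _ _ _ _ _ cexp0).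
  suff: nbhs (0 : C) (fun t => t != 0 -> normc (1 - (cexp t - 1) / t) < e) by [].
  apply: (filterS _ (filterI (filterI n1 n2) (filterI n3 (filterI n4 n5)))) => h [[/= h1 h2] [/= h3 [h4 h5]]] hn0.
  have nh0 : 0 < normc h by rewrite lt_neqAle eq_sym normc_eq0 hn0 normc_ge0.
  rewrite (_ : 1 - _ = - ((cexp h - 1 - h) / h)); last by field.
  rewrite normcN Normc.normcM Normc.normcV ltr_pdivrMr// (le_lt_trans (normc_le _))//.
  have hx := abs_Re_le h; have hy := abs_Im_le h; case: h => x y /= in nh0 hx hy h1 h2 h3 h4 h5 hn0 *.
  rewrite !addr0 expR0 cos0 sin0 oppr0 !mul0r !subr0 !mul1r in h1 h2 h3 *.
  rewrite ?addr0 in h3 *.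
  set N := Num.sqrt _ in hx hy nh0 *.
  have -> : expR x * cos y - 1 - x = (expR x - 1 - x) + expR x * (cos y - 1) by ring.
  have -> : expR x * sin y - y = expR x * (sin y - y) + (expR x - 1) * y by ring.
  have ex0 := expR_ge0 x.
  have k1 : `|expR x * (cos y - 1)| <= 2 * (e / 12 * N).
    by rewrite normrM ger0_norm// ler_pM//; [exact: ltW|rewrite (le_trans h2)// ler_wpM2l// ltW].
  have k2 : `|expR x * (sin y - y)| <= 2 * (e / 12 * N).
    by rewrite normrM ger0_norm// ler_pM//; [exact: ltW|rewrite (le_trans h3)// ler_wpM2l// ltW].
  have k3 : `|(expR x - 1) * y| <= e / 12 * N.
    by rewrite normrM ler_pM//; rewrite distrC ltW.
  have k4 : `|expR x - 1 - x| <= e / 12 * N.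
    by rewrite (le_trans h1)// ler_wpM2l// ltW.
  have eN : 0 < e * N by rewrite mulr_gt0.
  have := ler_normD (expR x - 1 - x) (expR x * (cos y - 1)).
  have := ler_normD (expR x * (sin y - y)) ((expR x - 1) * y).
  lra.
have -> : (fun h0 : C => h0^-1 *: (cexp (h0%:A + z) - cexp z)) = (fun h0 : C => cexp z * ((cexp h0 - 1) / h0)).
  by apply/funext => k; rewrite /GRing.scale/= mulr1 cexpD; ring.
by rewrite -[X in _ --> X]mulr1; apply: cvgMl_tmp.
Qed.

Lemma is_derive_comp_field (K : numFieldType) (f g : K -> K) (x df dg : K) :
  is_derive x 1 f df -> is_derive (f x) 1 g dg -> is_derive x 1 (g \o f) (dg * df).
Proof.
move=> [fx <-{df}] [gx <-{dg}]; split.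
  apply/derivable1_diffP/differentiable_comp; first exact/derivable1_diffP.
  by move/derivable1_diffP in gx.
move: fx gx => /derivable1_diffP fx /derivable1_diffP gx.
rewrite (deriveE _ (differentiable_comp fx gx)) (deriveE _ fx) (deriveE _ gx).
have -> : 'd (g \o f) x 1 = 'd g (f x) ('d f x 1) := congr1 (@^~ 1) (diff_comp fx gx).
have [l lE] : exists l : {linear K -> K}, l = 'd g (f x) by eexists.
rewrite -lE; set u := 'd f x 1.
have -> : l u = u *: l 1 by rewrite -linearZ /= /GRing.scale/= mulr1.
by rewrite mulrC.
Qed.

Lemma is_derive_horner (K : numFieldType) (p : {poly K}) (x : K) :
  is_derive x 1 (horner p) p^`().[x].
Proof.
elim/poly_ind: p => [|p c IH].
  rewrite (_ : horner 0 = cst 0); last by apply/funext => y; rewrite horner0.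
  by rewrite deriv0 horner0; exact: is_derive_cst.
rewrite (_ : horner _ = (horner p * id + cst c)); last first.
  by apply/funext => y; rewrite hornerMXaddC.
apply: is_derive_eq; rewrite derivMXaddC hornerD hornerMX /GRing.scale/=; ring.
Qed.

End ComplexTopology.

(** * The weight functions *)

Section Weight.
Variable R : realType.
Local Notation C := R[i].
Local Notation normc := (@Normc.normc R).
Implicit Types (z w : C) (x y s : R).

Lemma unit_diskE z : unit_disk z <-> normc z < 1.
Proof. by rewrite /unit_disk/= normCE -[1]/(1%:C) ltcR. Qed.

Lemma unit_circleE z : unit_circle z <-> normc z = 1.
Proof.
by rewrite /unit_circle/= normCE -[1]/(1%:C); split=> [/complexI|->].
Qed.

Lemma nbhs_unit_disk z : unit_disk z -> nbhs z (@unit_disk R).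
Proof.
move=> /unit_diskE z1; apply/nbhs_normcP; exists (1 - normc z); first by rewrite subr_gt0.
move=> w; rewrite ltrBrDr => h; apply/unit_diskE; apply: le_lt_trans h.
by rewrite -(normcN (z - w)) opprB -{1}(subrK z w) le_normcD.
Qed.

(** The radial points [z (1 - d)] approach [z] from inside, so limits from the disk are unique on
    the circle. *)
Lemma within_unit_disk_proper z : normc z = 1 -> ProperFilter (within (@unit_disk R) (nbhs z)).
Proof.
move=> z1; apply: Build_ProperFilter_ex => P; rewrite /within/= => /nbhs_normcP[e e0 eP].
pose d := Num.min (e / 2) (2^-1).
have d0 : 0 < d by rewrite lt_min divr_gt0//= invr_gt0.
have d1 : d < 1 by rewrite gt_min; apply/orP; right; rewrite invf_lt1// ltr1n.
exists (z * (1 - d)%:C); apply: eP; last first.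
  by apply/unit_diskE; rewrite Normc.normcM z1 mul1r normcR gtr0_norm ?subr_gt0// ltrBlDr ltrDl.
rewrite -{1}(mulr1 z) -mulrBr -[1 in X in X - _]/(1%:C) -raddfB opprB addrC subrK.
rewrite Normc.normcM z1 mul1r normcR gtr0_norm// gt_min; apply/orP; left.
by rewrite ltr_pdivrMr// ltr_pMr// ltr1n.
Qed.

(* The principal branch of [log (1 - z)] when [1 - z] is in the right half-plane. *)
Definition log1B z : C :=
  ln (normc (1 - z)) +i* atan (complex.Im (1 - z) / complex.Re (1 - z)).

Lemma cexp_log1B z : 0 < complex.Re (1 - z) -> cexp (log1B z) = 1 - z.
Proof.
rewrite /log1B; set u := 1 - z => Re0.
have u0 : 0 < normc u.
  by rewrite (lt_le_trans _ (abs_Re_le u))// normr_gt0 gt_eqF.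
rewrite /cexp/= lnK ?posrE// cos_atan_powR sin_atan.
set v := complex.Im u / complex.Re u.
have -> : (1 + v ^+ 2) `^ (- 2^-1) = complex.Re u / normc u.
  rewrite powRN powR12_sqrt; last by rewrite addr_ge0 ?sqr_ge0.
  rewrite -[LHS](invrK) invrK -[complex.Re u / _]invrK invf_div; congr _^-1.
  apply/eqP; rewrite -(@eqrXn2 _ 2) ?sqrtr_ge0 ?divr_ge0 ?ltW// sqr_sqrtr ?addr_ge0 ?sqr_ge0//.
  by rewrite [X in _ == X]expr_div_n normc_sqr /v; apply/eqP; field; rewrite gt_eqF.
rewrite [RHS]complexE; apply/eqP; rewrite eq_complex/=; apply/andP; split; apply/eqP.
  by rewrite ?(mul0r,mulr0,subr0,add0r,addr0) /v; field; rewrite gt_eqF.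
by rewrite ?(mul0r,mulr0,subr0,add0r,addr0,mul1r) /v; field; rewrite !gt_eqF.
Qed.

Lemma Re_1B_gt0 z : normc z <= 1 -> z != 1 -> 0 < complex.Re (1 - z).
Proof.
move=> z1 zN1; rewrite raddfB/= subr_gt0 ltNge; apply/negP => hz.
have : complex.Re z ^+ 2 + complex.Im z ^+ 2 <= 1 by rewrite -normc_sqr exprn_ile1 ?normc_ge0.
have : 1 <= complex.Re z ^+ 2 by rewrite exprn_ege1.
have := sqr_ge0 (complex.Im z) => h1 h2 h3.
have /eqP : complex.Im z ^+ 2 = 0 by lra.
rewrite sqrf_eq0 => /eqP Im0; move: zN1; rewrite (complexE z) Im0 mulr0 addr0 => /eqP; apply.
by congr _%:C; have := abs_Re_le z; rewrite ger0_norm; lra.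
Qed.

Lemma cvg_log1B z : 0 < complex.Re (1 - z) -> log1B w @[w --> z] --> log1B z.
Proof.
move=> Re0.
have c1 : (1 - w) @[w --> z] --> (1 - z : C) :=
  @cvgB _ _ _ (nbhs (z : C)) (nbhs_filter (z : C)) (cst (1 : C)) id 1 z (@cvg_cst _ _ _ _ (nbhs_filter (z : C))) (@cvg_id _ _).
have n1 : 0 < normc (1 - z).
  by rewrite (lt_le_trans _ (abs_Re_le _))// normr_gt0 gt_eqF.
have cRe : complex.Re (1 - w) @[w --> z] --> complex.Re (1 - z) :=
  cvg_comp _ _ c1 (@continuous_Re R (1 - z)).
have cIm : complex.Im (1 - w) @[w --> z] --> complex.Im (1 - z) :=
  cvg_comp _ _ c1 (@continuous_Im R (1 - z)).
have cn : normc (1 - w) @[w --> z] --> normc (1 - z) :=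
  cvg_comp _ _ c1 (@continuous_normc R (1 - z)).
apply: (@cvg_complex R _ (nbhs (z : C)) (nbhs_filter (z : C))).
  by apply: cvg_comp cn _; exact: continuous_ln.
have cq : (complex.Im (1 - w) / complex.Re (1 - w)) @[w --> z] -->
    complex.Im (1 - z) / complex.Re (1 - z).
  apply: (@cvgM _ _ (nbhs (z : C)) (nbhs_filter (z : C)) _ _ _ _ cIm).
  by apply: (@cvgV _ _ (nbhs (z : C)) (nbhs_filter (z : C)) _ _ _ cRe); rewrite gt_eqF.
by apply: cvg_comp cq _; exact: continuous_atan.
Qed.

(** Otherwise [cos (y - x) = 1] with [y - x] in [[0, pi]], which forces [x = y]. Half of the true
    gap [2 pi] is enough below. *)
Lemma cosN1_gap x y : x < y -> cos x = -1 -> cos y = -1 -> x + pi <= y.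
Proof.
move=> xy cx cy; rewrite leNgt; apply/negP => yx.
have sx : sin x = 0 by apply/eqP; rewrite -norm_cos_eq1 cx normrN1.
have : cos (y - x) = cos 0 by rewrite cosB sx cx cy cos0; ring.
move/cos_inj; rewrite !in_itv/= lexx pi_ge0 subr_ge0 ltW//= => /(_ _ isT) h.
by have := h ltac:(lra); lra.
Qed.

(** If the end values differed, [f] would take the value [pi] above the smaller one, where the
    cosine is 1. *)
Lemma continuous_cosN1_cst (f : R -> R) : {within `[0, 1], continuous f} ->
  (forall t, 0 <= t <= 1 -> cos (f t) = -1) -> f 0 = f 1.
Proof.
move=> cf cosf.
have gap x y : x < y -> cos x = -1 -> cos y = -1 -> Num.min (f 0) (f 1) = x ->
    Num.max (f 0) (f 1) = y -> False.
  move=> xy cx cy minE maxE.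
  have [|c] := @IVT _ f 0 1 (x + pi) ler01 cf.
    by rewrite minE maxE lerDl pi_ge0/= cosN1_gap.
  rewrite in_itv/= => /cosf + fc; rewrite fc cosDpi cx => /eqP.
  by rewrite opprK -subr_eq0 opprK -(natrD _ 1 1) pnatr_eq0.
have c0 : cos (f 0) = -1 by rewrite cosf// lexx ler01.
have c1 : cos (f 1) = -1 by rewrite cosf// lexx ler01.
case: (ltgtP (f 0) (f 1)) => // f01; [case: (gap _ _ f01 c0 c1)|case: (gap _ _ f01 c1 c0)].
- by rewrite min_l// ltW.
- by rewrite max_r// ltW.
- by rewrite min_r// ltW.
- by rewrite max_l// ltW.
Qed.

(** The difference [k] of the two logarithms satisfies [cexp k = -1], so it is imaginary, and
    constant along the segment from 0 to [z]. Being imaginary, it does not affect the modulus of the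
    weight. *)
Lemma log_branchE L : log_branch L ->
  exists2 k : C, complex.Re k = 0 & forall z, unit_disk z -> L z = log1B z + k.
Proof.
move=> hL; pose k z := L z - log1B z.
have Re1 z : unit_disk z -> 0 < complex.Re (1 - z).
  move=> /unit_diskE z1; apply: Re_1B_gt0; first exact: ltW.
  by apply: contraTneq z1 => ->; rewrite Normc.normc1 ltxx.
have ck z : unit_disk z -> cexp (k z) = -1.
  move=> z1; have [_ Lz] := hL _ z1; have lz := cexp_log1B (Re1 _ z1).
  apply: (mulIf (cexp_neq0 (log1B z))).
  by rewrite -cexpD subrK Lz lz; ring.
have Rek z : unit_disk z -> complex.Re (k z) = 0.
  move=> /ck /(congr1 normc); rewrite normc_cexp normcN Normc.normc1 -(@expR0 R).
  exact: expR_inj.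
have cosk z : unit_disk z -> cos (complex.Im (k z)) = -1.
  move=> z1; have := ck _ z1; rewrite /cexp (Rek _ z1) expR0 mul1r => /(congr1 (@complex.Re R)).
  by [].
have kc z : unit_disk z -> k w @[w --> z] --> k z.
  move=> z1; have [dL _] := hL _ z1.
  have cL : {for z, continuous L}.
    by apply: differentiable_continuous; apply/derivable1_diffP.
  exact: (@cvgB _ _ _ (nbhs (z : C)) (nbhs_filter (z : C)) _ _ _ _ cL (cvg_log1B (Re1 _ z1))).
exists (k 0); first by apply: Rek; apply/unit_diskE; rewrite Normc.normc0 ltr01.
move=> z z1; rewrite -[L z](subrK (log1B z)) addrC; congr (_ + _).
suff h : complex.Im (k 0) = complex.Im (k z).
  rewrite [LHS]complexE [RHS]complexE (Rek _ z1) (Rek 0) ?h//.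
  by apply/unit_diskE; rewrite Normc.normc0 ltr01.
have path t : 0 <= t <= 1 -> unit_disk (t%:C * z).
  move=> /andP[t0 t1]; apply/unit_diskE; rewrite Normc.normcM normcR ger0_norm//.
  by move/unit_diskE : z1; apply: le_lt_trans; rewrite ler_piMl ?normc_ge0.
have := @continuous_cosN1_cst (fun t => complex.Im (k (t%:C * z))).
rewrite !(mul0r, mul1r); apply; last by move=> t /path /cosk.
apply: continuous_in_subspaceT => t; rewrite inE/= in_itv/= => /path tz.
have c1 : (u%:C * z) @[u --> t] --> (t%:C * z).
  exact: (@cvgMr_tmp _ _ (nbhs t) _ (fun u => u%:C) _ z (@continuous_real_complex R t)).
exact: cvg_comp (cvg_comp _ _ c1 (kc _ tz)) (@continuous_Im R _).
Qed.

Lemma lim_within_disk (f : C -> C) z l : ProperFilter (within (@unit_disk R) (nbhs z)) ->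
  f x @[x --> within (@unit_disk R) (nbhs z)] --> l ->
  lim (f x @[x --> within (@unit_disk R) (nbhs z)]) = l.
Proof. by move=> FF fl; apply: cvg_lim fl; exact: norm_hausdorff. Qed.

Lemma cexpZ_cvg s z (f : C -> C) (F : set_system C) : Filter F ->
  f @ F --> z -> cexp (s%:C * f x) @[x --> F] --> cexp (s%:C * z).
Proof.
move=> FF fz; have sf : (s%:C * f x) @[x --> F] --> s%:C * z by exact: cvgMl_tmp.
apply: cvg_comp sf _; apply: differentiable_continuous; apply/derivable1_diffP.
by have [] := is_derive_cexp (s%:C * z).
Qed.

Lemma weight_disk L s z : log_branch L -> unit_disk z -> weight L s z = cexp (s%:C * L z).
Proof.
move=> hL z1; apply: lim_within_disk.
  apply: Build_ProperFilter_ex => P /nbhs_normcP[e e0 eP]; exists z; apply: eP => //.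
  by rewrite subrr Normc.normc0.
apply: cexpZ_cvg; apply: cvg_within_filter; have [dL _] := hL _ z1.
by apply: differentiable_continuous; apply/derivable1_diffP.
Qed.

(** Away from 1, the logarithm extends continuously to the circle. At 1 it does not, but there the
    weight tends to 0 in modulus or, for [s = 0], is constant. *)
Lemma normc_weight_circle L s z : log_branch L -> 0 <= s -> normc z = 1 ->
  normc (weight L s z) = normc (z - 1) `^ s.
Proof.
move=> hL s0 z1; have [k Rek LE] := log_branchE hL.
have FF := within_unit_disk_proper z1.
have Rew (x : C) : unit_disk x -> complex.Re (s%:C * L x) = s * ln (normc (1 - x)).
  by move=> x1; rewrite LE//; case: k Rek {LE} => ? ? /= ->; rewrite mul0r subr0 addr0.
have lime l : cexp (s%:C * L x) @[x --> within (@unit_disk R) (nbhs z)] --> l ->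
  weight L s z = l by exact: lim_within_disk.
have [zE|zN1] := eqVneq z 1.
  have [->|sN0] := eqVneq s 0.
    rewrite powRr0 (_ : weight L 0 z = 1) ?Normc.normc1//; apply: lim_within_disk.
    have -> : (fun x : C => cexp ((0 : R)%:C * L x)) = cst 1.
      by apply/funext => x; rewrite mul0r cexp0.
    exact: cvg_cst.
  have sp : 0 < s by rewrite lt_neqAle eq_sym sN0.
  rewrite (lime 0); first by rewrite zE subrr !Normc.normc0 powR0.
  apply/cvg_normcP => e e0; apply/nbhs_normcP; exists (e `^ s^-1); first by rewrite powR_gt0.
  move=> x zx x1; rewrite sub0r normcN normc_cexp Rew// -zE.
  have n0 : 0 < normc (z - x).
    rewrite lt_neqAle eq_sym normc_eq0 normc_ge0 andbT subr_eq0 zE.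
    by apply: contraTneq x1 => <-; apply/negP => /unit_diskE; rewrite Normc.normc1 ltxx.
  have -> : expR (s * ln (normc (z - x))) = normc (z - x) `^ s by rewrite /powR gt_eqF.
  rewrite (lt_le_trans (gt0_ltr_powR _ _ _ zx)) ?nnegrE ?normc_ge0 ?powR_ge0//.
  by rewrite -powRrM mulVf// powRr1// ltW.
have Re0 : 0 < complex.Re (1 - z) by apply: Re_1B_gt0; rewrite ?z1.
rewrite (lime (cexp (s%:C * (log1B z + k)))).
  rewrite normc_cexp /powR normc_eq0 subr_eq0 (negbTE zN1) -(normcN (z - 1)) opprB.
  by case: k Rek {LE} => ? ? /= ->; rewrite mul0r subr0 addr0.
have c2 : (log1B x + k) @[x --> within (@unit_disk R) (nbhs z)] --> log1B z + k.
  apply: cvg_within_filter.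
  exact: (@cvgD _ _ _ (nbhs (z : C)) (nbhs_filter (z : C)) _ _ _ _ (cvg_log1B Re0)
    (@cvg_cst _ _ _ _ (nbhs_filter (z : C)))).
have FF1 : Filter (within (@unit_disk R) (nbhs z)) by exact: within_filter.
have /cvg_normcP c3 := @cexpZ_cvg s _ _ _ FF1 c2.
apply/cvg_normcP => e /c3 c3e.
have c3n : nbhs z (fun w => unit_disk w ->
  normc (cexp (s%:C * (log1B z + k)) - cexp (s%:C * (log1B w + k))) < e) := c3e.
suff: nbhs z (fun w => unit_disk w ->
  normc (cexp (s%:C * (log1B z + k)) - cexp (s%:C * L w)) < e) by [].
by apply: (filterS _ c3n) => x h x1; rewrite LE//; exact: h.
Qed.

Lemma is_derive_weight_poly L s (P : {poly C}) z : log_branch L -> unit_disk z ->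
  is_derive z 1 (fun w => weight L (s + 1) w * P.[w])
    (weight L s z * ((s + 1)%:C *: P + ('X - 1) * P^`()).[z]).
Proof.
move=> hL z1; have [dL Lz] := hL _ z1; set l := 'D_1 L z.
have dLz : is_derive z 1 L l by exact: derivableP.
(* This comes from differentiating [cexp (L z) = z - 1]. *)
have ll : cexp (L z) * l = 1.
  have d1 := is_derive_comp_field dLz (is_derive_cexp (L z)).
  have d2 : is_derive z 1 (fun w : C => w - 1) 1.
    by apply: is_derive_eq; rewrite subr0.
  have : is_derive z 1 (fun w : C => w - 1) (cexp (L z) * l).
    apply: (near_eq_is_derive _ d1).
    by apply: filterS (nbhs_unit_disk z1) => w /hL[].
  by move=> [_ <-]; case: d2.
have dsL : is_derive z 1 (fun w => (s + 1)%:C * L w) ((s + 1)%:C * l).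
  exact: (is_deriveZ _ dLz).
have dw := is_derive_comp_field dsL (is_derive_cexp _).
have dP := is_derive_horner P z.
have dF := is_deriveM dw dP.
apply: (near_eq_is_derive _ (is_derive_eq dF _)).
  by apply: filterS (nbhs_unit_disk z1) => w w1; rewrite /= weight_disk.
rewrite /GRing.scale/= weight_disk// hornerD hornerM hornerXsubC hornerZ.
have -> : (s + 1)%:C * L z = s%:C * L z + L z by rewrite raddfD/= mulrDl mul1r.
rewrite cexpD; move: ll; set u := cexp (s%:C * L z); set v := cexp (L z) => vl.
rewrite (_ : v = z - 1) // in vl *.
transitivity (u * ((s + 1)%:C * (((z - 1) * l) * P.[z]) + (z - 1) * P^`().[z])); first by ring.
by rewrite vl mul1r.
Qed.

End Weight.

(** * From the circle to the real line *)

Section Cayley.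
Variable R : realType.
Local Notation C := R[i].
Local Notation normc := (@Normc.normc R).
Implicit Types (z w : C) (x y s t : R).

(** This is [- e^(2 i atan t)]. It runs over the circle without 1, to which the point at infinity
    corresponds. *)
Definition cayley t : C := - (1 +i* t) / (1 -i* t).

Lemma cayley_den_neq0 t : (1 -i* t : C) != 0.
Proof. by rewrite eq_complex/= oner_eq0. Qed.

Lemma normc_cayley_den t : normc (1 -i* t) = (1 + t ^+ 2) `^ 2^-1.
Proof. by rewrite powR12_sqrt ?ltW ?sqrD1_gt0//= expr1n sqrrN. Qed.

Lemma normc_cayley t : normc (cayley t) = 1.
Proof.
rewrite /cayley Normc.normcM normcN Normc.normcV normc_cayley_den /= expr1n.
by rewrite powR12_sqrt ?divff ?ltW ?sqrD1_gt0// gt_eqF// sqrtr_gt0 sqrD1_gt0.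
Qed.

Lemma cayleyB1 t : (1 -i* t) * (cayley t - 1) = - 2.
Proof.
rewrite mulrBr mulr1 /cayley mulrC divfK ?cayley_den_neq0//.
by apply/eqP; rewrite eq_complex/=; apply/andP; split; apply/eqP; ring.
Qed.

Lemma normc_cayleyB1 t : normc (cayley t - 1) = 2 * (1 + t ^+ 2) `^ (- 2^-1).
Proof.
have /(congr1 normc) := cayleyB1 t; rewrite Normc.normcM normcN normc_cayley_den.
rewrite -[2 : C](rmorph_nat (real_complex R)) normcR ger0_norm// => e.
have a0 : (1 + t ^+ 2) `^ 2^-1 != 0 by rewrite gt_eqF// powR_gt0// sqrD1_gt0.
by rewrite powRN -(mulKf a0 (normc _)) e mulrC.
Qed.

Lemma cayleyP z : normc z = 1 -> z != 1 -> exists t, z = cayley t.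
Proof.
move=> z1 zN1; have h := normc_sqr z; rewrite z1 expr1n in h.
have := Re_1B_gt0 _ zN1; rewrite z1 lexx raddfB/= => /(_ isT) x1.
have x0 : 1 - complex.Re z != 0 by rewrite gt_eqF.
have [q hq] : exists q, q * (1 - complex.Re z) = - complex.Im z.
  by exists (- complex.Im z / (1 - complex.Re z)); rewrite divfK.
exists q; apply: (mulIf (cayley_den_neq0 q)); rewrite divfK ?cayley_den_neq0//.
case: z {z1 zN1} h x1 x0 hq => x y /= h x1 x0 hq.
have hqx := congr1 (fun v => v * x) hq; have hqy := congr1 (fun v => v * y) hq.
apply/eqP; rewrite eq_complex/=; apply/andP; split; apply/eqP; apply: (mulIf x0); rewrite /= in hqx hqy *; lra.
Qed.

(* If [u ^+ 2 = z] and [normc u = 1], then [(1 - i t) (cayley t - z)] is [- u] times the real number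
   [2 Re u + 2 t Im u]. *)
Lemma circle_roots_real_poly (r : seq C) : all (fun z => normc z == 1) r ->
  exists (k : C) (p : {poly R}), [/\ normc k = 1, (size p <= (size r).+1)%N,
  (forall t, (1 -i* t) ^+ size r * (\prod_(z <- r) ('X - z%:P)).[cayley t] = k * (p.[t])%:C) &
  (forall t, (1 -i* t) ^+ size r * ((cayley t - 1) * (\prod_(z <- r) ('X - z%:P))^`().[cayley t]) =
     k * ((size r)%:R * (p.[t])%:C - (t +i* 1) * (p^`().[t])%:C))].
Proof.
have d1 (K : comNzRingType) : (1 : {poly K})^`() = 0 by rewrite -polyC1 derivC.
elim: r => [|z r IH] /=.
  move=> _; exists 1, 1; split; rewrite ?Normc.normc1 ?size_poly1// => t.
    by rewrite big_nil !hornerC expr0 !mul1r.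
  by rewrite big_nil !d1 !horner0 !mulr0 mul0r subr0 mulr0.
move=> /andP[/eqP z1 /IH[k [p [k1 sp hp hp']]]].
set P := \prod_(z <- r) ('X - z%:P) in hp hp' *.
pose u := sqrtc z; have uz : u ^+ 2 = z by rewrite sqr_sqrtc.
have u1 : complex.Re u ^+ 2 + complex.Im u ^+ 2 = 1.
  rewrite -normc_sqr expr2 -Normc.normcM -expr2 uz z1 //.
(* [l] is the real linear factor belonging to the root [z]; the last equation is the derivative
   identity of the lemma for this factor alone. *)
have [l [v [sl dl key key2]]] : exists (l : {poly R}) (v : R), [/\ (size l <= 2)%N, l^`() = v%:P,
    forall t, (1 -i* t) * (cayley t - z) = - u * (l.[t])%:C &
    forall t, - 2 = - u * ((l.[t])%:C - (t +i* 1) * v%:C)].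
  pose l : {poly R} := (2 * complex.Re u)%:P + (2 * complex.Im u) *: 'X.
  exists l, (2 * complex.Im u); split.
  - rewrite (leq_trans (size_polyD _ _))// geq_max (leq_trans (size_polyC_leq1 _))//=.
    by rewrite (leq_trans (size_scale_leq _ _))// size_polyX.
  - by rewrite derivD derivC derivZ derivX add0r alg_polyC.
  - move=> t; rewrite mulrBr /cayley [X in X - _]mulrC divfK ?cayley_den_neq0// -uz /l !hornerE.
    have ut := congr1 (fun v => v * t) u1; case: u u1 {uz l} ut => a b /= u1 ut.
    by apply/eqP; rewrite eq_complex/=; apply/andP; split; apply/eqP; lra.
  move=> t; rewrite /l !hornerE; case: u u1 {uz l} => a b /= u1.
  by apply/eqP; rewrite eq_complex/=; apply/andP; split; apply/eqP; lra.
exists (- k * u), (p * l); split.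
- rewrite Normc.normcM normcN k1 mul1r; apply/eqP.
  by rewrite -(@eqrXn2 _ 2) ?normc_ge0 ?ler01// normc_sqr u1 expr1n.
- apply: leq_trans (size_polyMleq _ _) _; have := leq_add sp sl; rewrite addn2.
  by case: (size p + size l)%N.
- move=> t; rewrite big_cons hornerM hornerXsubC exprS mulrACA hp key hornerM rmorphM/=; ring.
move=> t; rewrite big_cons derivM derivXsubC mul1r hornerD hornerM hornerXsubC exprS -/P.
transitivity (((1 -i* t) * (cayley t - 1)) * ((1 -i* t) ^+ size r * P.[cayley t]) +
  ((1 -i* t) * (cayley t - z)) * ((1 -i* t) ^+ size r * ((cayley t - 1) * P^`().[cayley t]))).
  by ring.
rewrite cayleyB1 hp hp' key (key2 t) derivM dl hornerD !hornerM hornerC rmorphD !rmorphM/= -natr1.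
by ring.
Qed.

(** * The weighted norm on the circle *)

Section WeightedNorm.
Variables (L : C -> C) (s : R).
Hypotheses (hL : log_branch L) (s0 : 0 <= s).
Implicit Types P Q : {poly C}.

(** The weight is at most [2^s] and [P] at most the sum of the moduli of its coefficients, so that
    the [sup] in the norm is a true supremum. *)
Lemma weighted_norm_has_sup P :
  has_sup [set normc (weight L s z * P.[z]) | z in @unit_circle R].
Proof.
split; first by exists (normc (weight L s 1 * P.[1])), 1 => //; apply/unit_circleE; rewrite Normc.normc1.
exists (2 `^ s * \sum_(i < size P) normc P`_i) => _ [z /unit_circleE z1 <-].
rewrite Normc.normcM normc_weight_circle// ler_pM ?powR_ge0 ?normc_ge0//.
  rewrite ge0_ler_powR ?nnegrE ?normc_ge0// (le_trans (le_normcD _ _))//.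
  by rewrite normcN z1 Normc.normc1.
rewrite horner_coef; elim/big_ind2 : _ => [|x1 y1 x2 y2 h1 h2|i _]; first by rewrite Normc.normc0.
  by rewrite (le_trans (le_normcD _ _))// lerD.
rewrite Normc.normcM; suff -> : normc (z ^+ i) = 1 by rewrite mulr1.
by elim: (nat_of_ord i) => [|k IH]; rewrite ?expr0 ?Normc.normc1// exprS Normc.normcM z1 IH mulr1.
Qed.

Lemma le_weighted_norm P z : normc z = 1 ->
  normc (z - 1) `^ s * normc P.[z] <= weighted_norm (weight L s) P.
Proof.
move=> z1; rewrite -(normc_weight_circle hL s0 z1) -Normc.normcM.
apply: ub_le_sup; first by have [] := weighted_norm_has_sup P.
by exists z => //; apply/unit_circleE.
Qed.

Lemma weighted_norm_le P (M : R) :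
  (forall z, normc z = 1 -> normc (z - 1) `^ s * normc P.[z] <= M) ->
  weighted_norm (weight L s) P <= M.
Proof.
move=> h; apply: ge_sup; first by have [] := weighted_norm_has_sup P.
move=> _ [z /unit_circleE z1 <-]; rewrite Normc.normcM normc_weight_circle//.
exact: h.
Qed.

Lemma weighted_norm_ge0 P : 0 <= weighted_norm (weight L s) P.
Proof.
apply: le_trans (le_weighted_norm P (Normc.normc1 R)).
by rewrite mulr_ge0 ?powR_ge0 ?normc_ge0.
Qed.

End WeightedNorm.

(* [T_P], characterised by [(w_(s+1) P)' = (s + n + 1) w_s T_P]. *)
Definition lax_poly s (n : nat) (P : {poly C}) : {poly C} :=
  ((s + n%:R + 1)%:C)^-1 *: ((s + 1)%:C *: P + ('X - 1) * P^`()).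

(** Up to constants and powers of [1 - i t], the Cayley transform carries [P] to a real [p] and [T]
    to [a p - (t + i) p'], whose squared modulus is the left side of [bernstein_halfplane]. *)
Lemma weighted_norm_lax_poly (L : C -> C) s (r : seq C) : log_branch L -> 0 <= s ->
  all (fun z => normc z == 1) r ->
  weighted_norm (weight L s) (lax_poly s (size r) (\prod_(z <- r) ('X - z%:P))) <=
  2^-1 * weighted_norm (weight L (s + 1)) (\prod_(z <- r) ('X - z%:P)).
Proof.
move=> hL s0 r1; set P := \prod_(z <- r) _; set M := weighted_norm (weight L (s + 1)) P.
set T := lax_poly s (size r) P; set n := size r; pose a := s + n%:R + 1.
have s10 : 0 <= s + 1 by rewrite addr_ge0.
have na : n%:R + 1 <= a by rewrite /a; lra.
have a0 : 0 < a by rewrite (lt_le_trans _ na)// ltr_wpDl.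
have [k [p [k1 sp hp hp']]] := circle_roots_real_poly r1.
rewrite -/P -/n in sp hp hp'.
have nE t : normc (1 -i* t) ^+ n = (1 + t ^+ 2) `^ (n%:R / 2).
  by rewrite normc_cayley_den -[LHS]powR_mulrn ?powR_ge0// -powRrM mulrC.
have normcX z m : normc (z ^+ m) = normc z ^+ m.
  by elim: m => [|m IH]; rewrite ?expr0 ?Normc.normc1// !exprS Normc.normcM IH.
have rD t x y : (1 + t ^+ 2) `^ x * (1 + t ^+ 2) `^ y = (1 + t ^+ 2) `^ (x + y).
  by rewrite powRD// (gt_eqF (sqrD1_gt0 t)) implybT.
(* The power of 2 comes from [|cayley t - 1| = 2 (1 + t^2)^(- 1/2)], and the exponents of [1 + t^2]
   add up because [a = s + n + 1]. *)
have pM t : `|p.[t]| <= M / 2 `^ (s + 1) * (1 + t ^+ 2) `^ (a / 2).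
  have := le_weighted_norm hL s10 P (normc_cayley t); rewrite -/M.
  have := congr1 normc (hp t); rewrite !Normc.normcM k1 mul1r normcR normcX nE => <-.
  rewrite normc_cayleyB1 powRM ?powR_ge0// -powRrM => h.
  have q0 : 0 < (1 + t ^+ 2) `^ (a / 2) / 2 `^ (s + 1) by rewrite divr_gt0 ?powR_gt0 ?sqrD1_gt0.
  move: h; rewrite -(ler_pM2r q0); congr (is_true (_ <= _)); last by rewrite mulrA mulrAC.
  transitivity ((1 + t ^+ 2) `^ (- 2^-1 * (s + 1)) * (1 + t ^+ 2) `^ (a / 2) * normc P.[cayley t]).
    by field; rewrite gt_eqF ?powR_gt0.
  by rewrite rD; congr (_ `^ _ * _); rewrite /a; field.
have bern t := @bernstein_halfplane R n (M / 2 `^ (s + 1)) a p t na sp pM.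
(* The weight contributes [2^s] against the [2^(s + 1)] of [pM], whence the factor one half. *)
have off1 z : normc z = 1 -> z != 1 -> normc (z - 1) `^ s * normc T.[z] <= 2^-1 * M.
  move=> z1 /(cayleyP z1)[t ->] {z z1}.
  have TE : (1 -i* t) ^+ n * (a%:C * T.[cayley t]) = k * (a%:C * (p.[t])%:C - (t +i* 1) * (p^`().[t])%:C).
    rewrite /T /lax_poly hornerZ -/n -/a mulVKf; last by rewrite -[0]/(0%:C) (inj_eq (@complexI R)) gt_eqF.
    rewrite hornerD hornerZ hornerM hornerXsubC mulrDr hp' mulrCA hp.
    have -> : a%:C = (s + 1)%:C + n%:R.
      by rewrite -(rmorph_nat (real_complex R)) -rmorphD/=; congr _%:C; rewrite /a; ring.
    ring.
  have M'0 : 0 <= M / 2 `^ (s + 1) by rewrite divr_ge0 ?powR_ge0//; exact: weighted_norm_ge0.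
  have h : normc (a%:C * (p.[t])%:C - (t +i* 1) * (p^`().[t])%:C) <=
      a * (M / 2 `^ (s + 1)) * (1 + t ^+ 2) `^ ((a - 1) / 2).
    move: (M / _) (bern t) M'0 => M' bt M'0.
    rewrite -(@ler_pXn2r _ 2) ?nnegrE ?normc_ge0 ?mulr_ge0 ?powR_ge0 ?(ltW a0)//.
    rewrite !exprMn -[X in _ <= _ * X]powR_mulrn ?powR_ge0// -powRrM divfK//.
    apply: le_trans bt; rewrite normc_sqr /= le_eqVlt; apply/orP; left; apply/eqP; ring.
  move: h; have := congr1 normc TE.
  rewrite !Normc.normcM k1 mul1r normcR normcX nE (gtr0_norm a0) => <-.
  rewrite normc_cayleyB1 powRM ?powR_ge0// -powRrM mulrCA -mulrA ler_pM2l// => h.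
  have q0 : 0 < (1 + t ^+ 2) `^ (- (n%:R / 2 + s / 2)) * 2 `^ s by rewrite mulr_gt0 ?powR_gt0 ?sqrD1_gt0.
  move: h; rewrite -(ler_pM2r q0); congr (is_true (_ <= _)).
    transitivity (2 `^ s * ((1 + t ^+ 2) `^ (n%:R / 2) * (1 + t ^+ 2) `^ (- (n%:R / 2 + s / 2))) * normc T.[cayley t]).
      by ring.
    by rewrite rD; congr (_ * _ `^ _ * _); field.
  transitivity ((1 + t ^+ 2) `^ ((a - 1) / 2) * (1 + t ^+ 2) `^ (- (n%:R / 2 + s / 2)) * (M / 2 `^ (s + 1) * 2 `^ s)).
    by ring.
  rewrite rD (_ : (a - 1) / 2 + _ = 0); last by rewrite /a; field.
  rewrite powRr0 mul1r powRD ?pnatr_eq0 ?implybT// powRr1//.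
  by field; rewrite gt_eqF ?powR_gt0.
(* The point 1 is out of reach of [cayley]. The weight vanishes there if [s > 0], and for [s = 0]
   the bound extends by continuity of [T]. *)
apply: weighted_norm_le => // z z1; have [->|zN1] := eqVneq z 1; last exact: off1.
rewrite subrr Normc.normc0; have [sE|sN0] := eqVneq s 0; last first.
  rewrite powR0// mul0r mulr_ge0 ?invr_ge0//; exact: weighted_norm_ge0.
rewrite sE powRr0 mul1r leNgt; apply/negP => T1.
have cT : normc T.[w] @[w --> (1 : C)] --> normc T.[1].
  have [dT _] := is_derive_horner T 1.
  have cT : T.[w] @[w --> (1 : C)] --> T.[1].
    by apply: differentiable_continuous; apply/derivable1_diffP.
  exact: cvg_comp cT (@continuous_normc R _).
have : nbhs (1 : C) (fun w => 2^-1 * M < normc T.[w]).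
  exact: (@cvgr_gt _ _ _ _ _ _ cT _ T1).
(* The parameter [2 / e] gives a point at distance less than [e] from 1. *)
move=> /nbhs_normcP[e e0 /(_ (cayley (2 / e)))]; set t := 2 / e.
have t0 : 0 < t by rewrite divr_gt0.
rewrite -normcN opprB normc_cayleyB1 powRN powR12_sqrt ?ltW ?sqrD1_gt0//.
have -> : 2 / Num.sqrt (1 + t ^+ 2) < e.
  rewrite ltr_pdivrMr ?sqrtr_gt0 ?sqrD1_gt0// -ltr_pdivrMl// mulrC -/t.
  by rewrite -{1}(gtr0_norm t0) -sqrtr_sqr ltr_sqrt ?sqrD1_gt0// ltrDr.
move=> /(_ isT); rewrite ltNge => /negP; apply.
have := off1 _ (normc_cayley t); rewrite sE powRr0 mul1r; apply.
by apply/eqP => e1; have := cayleyB1 t; rewrite e1 subrr mulr0 => /eqP; rewrite eq_sym oppr_eq0 pnatr_eq0.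
Qed.

End Cayley.

(** * Polynomials with roots in the disk or on the circle *)

Section Extremal.
Variable R : realType.
Local Notation C := R[i].
Local Notation normc := (@Normc.normc R).
Implicit Types (z w a : C) (x y s t : R) (r : seq C) (n : nat) (P Q T D : {poly C}).

Definition roots_poly r : {poly C} := \prod_(z <- r) ('X - z%:P).

Lemma roots_poly_monic r : roots_poly r \is monic.
Proof. exact: monic_prod_XsubC. Qed.

Lemma size_roots_poly r : size (roots_poly r) = (size r).+1.
Proof. exact: size_prod_XsubC. Qed.

Lemma monic_roots_poly Q : Q \is monic -> exists2 r, (size r).+1 = size Q & Q = roots_poly r.
Proof.
move=> Qm; have [r Qr] := closed_field_poly_normal Q.
move: Qr; rewrite (monicP Qm) scale1r => Qr; exists r => //.
by rewrite Qr size_roots_poly.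
Qed.

Lemma poly_of_roots_seq n (a : 'I_n -> C) : poly_of_roots a = roots_poly [seq a k | k <- enum 'I_n].
Proof. by rewrite /poly_of_roots /roots_poly big_map big_enum. Qed.

Lemma seq_poly_of_roots r : roots_poly r = poly_of_roots (fun k : 'I_(size r) => nth 0 r k).
Proof. by rewrite /roots_poly (big_nth 0) big_mkord. Qed.

Lemma normc_roots_poly r z : normc (roots_poly r).[z] = \prod_(a <- r) normc (z - a).
Proof.
rewrite /roots_poly horner_prod.
elim: r => [|a r IH]; rewrite ?big_nil ?Normc.normc1// !big_cons Normc.normcM IH.
by rewrite hornerXsubC.
Qed.

Lemma normc_gt0 z : (0 < normc z) = (z != 0).
Proof. by rewrite lt_neqAle normc_ge0 andbT eq_sym normc_eq0. Qed.

(** The identity behind Blaschke factors: for [a] in the disk, it tells which modulus is the larger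
    one inside, on and outside the circle. *)
Lemma normc_conjB a z : normc (1 - a^*%C * z) ^+ 2 - normc (z - a) ^+ 2 =
  (1 - normc a ^+ 2) * (1 - normc z ^+ 2).
Proof. by rewrite !normc_sqr; case: a z => a1 a2 [z1 z2] /=; ring. Qed.

Lemma normc_conjB_circle a z : normc z = 1 -> normc (1 - a^*%C * z) = normc (z - a).
Proof.
move=> z1; apply/eqP; rewrite -(@eqrXn2 _ 2) ?normc_ge0// -subr_eq0 normc_conjB z1.
by rewrite expr1n subrr mulr0.
Qed.

Lemma normc_conjB_le a z : normc a <= 1 -> normc z <= 1 -> normc (z - a) <= normc (1 - a^*%C * z).
Proof.
move=> a1 z1; rewrite -(@ler_pXn2r _ 2) ?nnegrE ?normc_ge0// -subr_ge0 normc_conjB.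
by rewrite mulr_ge0// subr_ge0 exprn_ile1 ?normc_ge0.
Qed.

Lemma normc_conjB_ge a z : normc a <= 1 -> 1 <= normc z -> normc (1 - a^*%C * z) <= normc (z - a).
Proof.
move=> a1 z1; rewrite -(@ler_pXn2r _ 2) ?nnegrE ?normc_ge0// -subr_ge0 -opprB normc_conjB.
by rewrite -mulrN opprB mulr_ge0// subr_ge0 ?exprn_ile1 ?normc_ge0// exprn_ege1.
Qed.

(* Replacing a root outside of the disk by its reflection decreases the modulus on the circle. *)
Lemma reflect_roots r : exists r', [/\ size r' = size r, all (fun a => normc a <= 1) r' &
  forall z, normc z = 1 -> normc (roots_poly r').[z] <= normc (roots_poly r).[z]].
Proof.
exists [seq (if normc a <= 1 then a else (a^*%C)^-1) | a <- r]; split.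
- by rewrite size_map.
- apply/allP => _ /mapP[a _ ->]; case: ifPn => //; rewrite -ltNge => a1.
  by rewrite Normc.normcV normc_conj invf_le1 ?ltW// (lt_trans _ a1).
move=> z z1; rewrite !normc_roots_poly big_map; apply: ler_prod => a _.
rewrite normc_ge0 /=; case: ifPn => //; rewrite -ltNge => a1.
have a0 : a^*%C != 0 by rewrite conjc_eq0 -normc_gt0 (lt_trans _ a1).
rewrite -(normc_conjB_circle a z1) (_ : 1 - a^*%C * z = - (a^*%C * (z - (a^*%C)^-1))).
  by rewrite normcN Normc.normcM normc_conj ler_peMl ?normc_ge0// ltW.
by rewrite mulrBr divff//; ring.
Qed.

(* [T^*(z) = z^n conj(T(1 / conj z))] for [T = roots_poly r] of degree [n]. *)
Definition dual_poly r : {poly C} := \prod_(a <- r) (1 - a^*%C *: 'X).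

Lemma horner_dual_poly r z : (dual_poly r).[z] = \prod_(a <- r) (1 - a^*%C * z).
Proof.
by rewrite /dual_poly horner_prod; apply: eq_bigr => a _; rewrite !hornerE.
Qed.

Lemma normc_dual_poly r z : normc (dual_poly r).[z] = \prod_(a <- r) normc (1 - a^*%C * z).
Proof.
rewrite horner_dual_poly; elim: r => [|a r IH]; rewrite ?big_nil ?Normc.normc1//.
by rewrite !big_cons Normc.normcM IH.
Qed.

Lemma size_dual_poly r : (size (dual_poly r) <= (size r).+1)%N.
Proof.
rewrite /dual_poly; elim: r => [|a r IH]; first by rewrite big_nil size_poly1.
rewrite big_cons; set Q := \prod_(_ <- _) _ in IH *; set l := 1 - _.
have sl : (size l <= 2)%N.
  rewrite (leq_trans (size_polyD _ _))// geq_max size_poly1 size_polyN/=.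
  by rewrite (leq_trans (size_scale_leq _ _))// size_polyX.
apply: leq_trans (size_polyMleq _ _) _; have := leq_add sl IH; rewrite add2n.
by case: (size l + size Q)%N.
Qed.

(* The polynomial [z T(z) - c T^*(z)] with [T^*] the dual of [T] has all its roots on the circle,
   since [|T| <= |T^*|] inside of the disk and [|T^*| <= |T|] outside. *)
Lemma circle_companion r : all (fun a => normc a <= 1) r ->
  exists r', [/\ size r' = size r, all (fun a => normc a == 1) r' &
  forall z, normc z = 1 -> normc (z - 1) * normc (roots_poly r').[z] <= 2 * normc (roots_poly r).[z]].
Proof.
move=> /allP r1; set T := roots_poly r; set T' := dual_poly r.
have T'1 : normc T'.[1] = normc T.[1].
  rewrite normc_dual_poly normc_roots_poly; apply: eq_bigr => a _.
  by rewrite normc_conjB_circle ?Normc.normc1.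
(* If [T] vanishes at 1, so does its dual, and any [c] of modulus 1 serves. *)
have [c c1 cT] : exists2 c, normc c = 1 & T.[1] = c * T'.[1].
  have [T0|T0] := eqVneq T.[1] 0.
    exists 1; first by rewrite Normc.normc1.
    by apply/esym/eqP; rewrite mul1r T0 -normc_eq0 T'1 T0 Normc.normc0.
  have T'0 : T'.[1] != 0 by rewrite -normc_eq0 T'1 normc_eq0.
  exists (T.[1] / T'.[1]); last by rewrite divfK.
  by rewrite Normc.normcM Normc.normcV T'1 divff// normc_eq0.
pose H := T * 'X - c *: T'.
have sH : (size (c *: T') < size (T * 'X)%R)%N.
  rewrite size_mulX ?monic_neq0 ?roots_poly_monic// size_roots_poly.
  by rewrite (leq_ltn_trans (size_scale_leq _ _))// ltnS size_dual_poly.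
have Hm : H \is monic.
  rewrite monicE /H lead_coefDl ?size_polyN// lead_coefMX.
  exact: (roots_poly_monic r).
have [q sq Hq] := monic_roots_poly Hm.
move: sq; rewrite /H size_polyDl ?size_polyN// size_mulX ?monic_neq0 ?roots_poly_monic//.
rewrite size_roots_poly => -[sq].
have Hz z : H.[z] = z * T.[z] - c * T'.[z] by rewrite /H !hornerE mulrC.
(* At a root, [|z| |T| = |T'|]. Off the circle the factor [|z|] makes the comparison of [T] and [T']
   strict, as the larger of the two does not vanish there. *)
have rootH z : H.[z] = 0 -> normc z = 1.
  rewrite Hz => /eqP; rewrite subr_eq0 => /eqP /(congr1 normc).
  rewrite !Normc.normcM c1 mul1r normc_roots_poly normc_dual_poly => e.
  case: (ltgtP (normc z) 1) => // z1.
    have p0 : 0 < \prod_(a <- r) normc (1 - a^*%C * z).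
      rewrite big_seq prodr_gt0// => a ar; rewrite normc_gt0 subr_eq0.
      apply/eqP => /(congr1 normc); rewrite Normc.normc1 Normc.normcM normc_conj => e1.
      have := r1 _ ar => a1; have : normc a * normc z < 1.
        by rewrite (le_lt_trans _ z1)// ler_piMl ?normc_ge0.
      by rewrite -e1 ltxx.
    have p1 : \prod_(a <- r) normc (z - a) <= \prod_(a <- r) normc (1 - a^*%C * z).
      rewrite !big_seq; apply: ler_prod => a ar.
      by rewrite normc_ge0 (normc_conjB_le (r1 _ ar) (ltW z1)).
    have : normc z * \prod_(a <- r) normc (z - a) < \prod_(a <- r) normc (1 - a^*%C * z).
      apply: (@le_lt_trans _ _ (normc z * \prod_(a <- r) normc (1 - a^*%C * z))).
        by rewrite ler_wpM2l ?normc_ge0.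
      by rewrite gtr_pMl.
    by rewrite e ltxx.
  have p0 : 0 < \prod_(a <- r) normc (z - a).
    rewrite big_seq prodr_gt0// => a ar; rewrite normc_gt0 subr_eq0.
    by apply/eqP => za; have := r1 _ ar; rewrite -za leNgt z1.
  have p1 : \prod_(a <- r) normc (1 - a^*%C * z) <= \prod_(a <- r) normc (z - a).
    rewrite !big_seq; apply: ler_prod => a ar.
    by rewrite normc_ge0 (normc_conjB_ge (r1 _ ar) (ltW z1)).
  have : \prod_(a <- r) normc (z - a) < normc z * \prod_(a <- r) normc (z - a) by rewrite ltr_pMl.
  by rewrite e ltNge p1.
have memq z : (z \in q) = (H.[z] == 0) by rewrite Hq /roots_poly -root_prod_XsubC.
have q1 : 1 \in q by rewrite memq Hz cT mul1r subrr.
(* Only one occurrence of the root 1 is removed, which divides [H] by [z - 1]. *)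
exists (rem 1 q); split.
- by rewrite size_rem// sq.
- by apply/allP => z /mem_rem; rewrite memq => /eqP/rootH ->.
move=> z z1; rewrite -Normc.normcM -[z - 1](hornerXsubC 1 z) -hornerM.
have -> : ('X - 1%:P) * roots_poly (rem 1 q) = H.
  by rewrite Hq /roots_poly (perm_big _ (perm_to_rem q1)) big_cons.
rewrite Hz (le_trans (le_normcD _ _))// normcN !Normc.normcM z1 c1 !mul1r.
have -> : normc T'.[z] = normc T.[z].
  rewrite normc_dual_poly normc_roots_poly; apply: eq_bigr => a _.
  by rewrite normc_conjB_circle.
by rewrite mulr_natl mulr2n.
Qed.

End Extremal.

(** * Chebyshev polynomials *)

Section Chebyshev.
Variable R : realType.
Local Notation C := R[i].
Local Notation normc := (@Normc.normc R).
Implicit Types (z w a : C) (x y s t : R) (r : seq C) (n : nat) (P Q T D : {poly C}).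

Lemma circle_angle z : normc z = 1 ->
  exists2 t, 0 <= t < 2 * pi & z = cexp ('i * t%:C).
Proof.
move=> z1; have := normc_sqr z; rewrite z1 expr1n; case: z z1 => x y z1 /= h.
have cexpi t : cexp ('i * t%:C) = cos t +i* sin t :> C.
  by rewrite /cexp /= !(mul0r, mul1r, mulr0, add0r, addr0, subr0, oppr0) expR0 mul1r.
have x1 : -1 <= x <= 1 by rewrite -ler_norml -z1; exact: (abs_Re_le (x +i* y)).
have sE : Num.sqrt (1 - x ^+ 2) = `|y| by rewrite h addrAC subrr add0r sqrtr_sqr.
have [y0|y0] := leP 0 y.
  exists (acos x); first by have := acos_ge0 x1; have := acos_lepi x1; have := @pi_gt0 R; lra.
  by rewrite cexpi acosK ?in_itv//= sin_acos// sE ger0_norm.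
(* In the lower half-plane the angle is [2 pi - acos x]; [x < 1] keeps it below [2 pi]. *)
have xlt1 : x < 1.
  by rewrite ltNge; apply/negP => x1'; have := sqr_ge0 x; nra.
exists (2 * pi - acos x).
  have xx : -1 <= x < 1 by rewrite xlt1; case/andP: x1 => ->.
  by have := acos_gt0 xx; have := acos_lepi x1; have := @pi_gt0 R; lra.
rewrite cexpi mulr_natl addrC cosD2pi sinD2pi cosN sinN acosK ?in_itv//= sin_acos// sE.
by rewrite ltr0_norm// opprK.
Qed.

(** This trades angles for a list of roots of modulus 1, the form in which [circle_companion] and
    [weighted_norm_lax_poly] are stated. *)
Lemma circle_polyP n P : (exists2 alpha, @angles R n alpha & P = circle_poly alpha) <->
  (exists r, [/\ size r = n, all (fun a => normc a == 1) r & P = roots_poly r]).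
Proof.
split=> [[alpha _ ->]|[r [<- /allP r1 ->]]].
  exists [seq cexp ('i * (alpha k)%:C) | k <- enum 'I_n]; split.
  - by rewrite size_map size_enum_ord.
  - apply/allP => _ /mapP[k _ ->]; rewrite normc_cexp/=.
    by rewrite !(mul0r, mul1r, mulr0, add0r, addr0, subrr, oppr0) expR0.
  - exact: poly_of_roots_seq.
have h (k : 'I_(size r)) : exists t, 0 <= t < 2 * pi /\ nth 0 r k = cexp ('i * t%:C).
  have /r1/eqP/circle_angle[t t0 ->] := mem_nth 0 (ltn_ord k).
  by exists t.
have [alpha ha] := choice h; exists alpha; first by move=> k; case: (ha k).
rewrite seq_poly_of_roots /circle_poly; congr poly_of_roots; apply/funext => k.
by case: (ha k).
Qed.

Section Weight.
Variable L : C -> C.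
Hypothesis hL : log_branch L.

(** The weight does not vanish at the points [cayley t], so a zero norm would give [Q] as many
    distinct roots as its size, one too many. *)
Lemma weighted_norm_gt0 s Q : 0 <= s -> Q \is monic -> 0 < weighted_norm (weight L s) Q.
Proof.
move=> s0 Qm; rewrite lt_neqAle weighted_norm_ge0// andbT eq_sym; apply/eqP => Q0.
have Qz t : Q.[cayley t] = 0.
  apply/eqP; rewrite -normc_eq0 eq_le normc_ge0 andbT.
  have := le_weighted_norm hL s0 Q (normc_cayley t); rewrite Q0 pmulr_rle0//.
  by rewrite powR_gt0// normc_cayleyB1 mulr_gt0// powR_gt0 ?sqrD1_gt0.
have cinj : injective (@cayley R).
  move=> u v uv; have := cayleyB1 u; rewrite -(cayleyB1 v) uv => /mulIf.
  have -> : cayley v - 1 != 0.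
    by apply/eqP => v0; have /eqP := cayleyB1 v; rewrite v0 mulr0 eq_sym oppr_eq0 pnatr_eq0.
  by move=> /(_ isT)[/oppr_inj].
have := @max_poly_roots _ Q [seq cayley k%:R | k <- iota 0 (size Q)] (monic_neq0 Qm).
rewrite size_map size_iota ltnn => h; apply/notF/h.
  by apply/allP => _ /mapP[k _ ->]; rewrite /root Qz.
by rewrite map_inj_uniq ?iota_uniq// => i j /cinj/eqP; rewrite eqr_nat => /eqP.
Qed.

Lemma monic_size_coef n Q : (size Q <= n.+1)%N -> Q`_n = 1 -> Q \is monic /\ size Q = n.+1.
Proof.
move=> sQ Qn; suff sQ' : size Q = n.+1 by rewrite monicE lead_coefE sQ' Qn eqxx.
apply/eqP; rewrite eqn_leq sQ ltnNge; apply/negP => /leq_sizeP/(_ n (leqnn n)).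
by rewrite Qn => /eqP; rewrite oner_eq0.
Qed.

Lemma monic_coef n Q : Q \is monic -> size Q = n.+1 -> Q`_n = 1.
Proof. by move=> /monicP; rewrite lead_coefE => + sQ; rewrite sQ. Qed.

Lemma parallelogram z w : normc ((z + w) / 2) ^+ 2 + normc (z - w) ^+ 2 / 4 =
  (normc z ^+ 2 + normc w ^+ 2) / 2.
Proof.
rewrite Normc.normcM exprMn Normc.normcV -[2 : C](rmorph_nat (real_complex R)) normcR ger0_norm//.
by rewrite !normc_sqr; case: z w => a b [c d] /=; field.
Qed.

(* If [T1] and [T2] were distinct minimisers, then their mean [T] would be a minimiser with
   [|w T|^2 + |w (T1 - T2)|^2 / 4 <= t^2] on the circle; subtracting a small multiple of
   [T mod (T1 - T2)] would decrease the norm of [T]. *)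
Lemma chebyshev_unique s n t T1 T2 : 0 <= s ->
  T1 \is monic -> size T1 = n.+1 -> T2 \is monic -> size T2 = n.+1 ->
  weighted_norm (weight L s) T1 <= t -> weighted_norm (weight L s) T2 <= t ->
  (forall Q, Q \is monic -> size Q = n.+1 -> t <= weighted_norm (weight L s) Q) ->
  T1 = T2.
Proof.
move=> s0 T1m sT1 T2m sT2 T1t T2t tmin; apply/eqP; rewrite -subr_eq0; apply/negPn/negP => D0.
set D := T1 - T2 in D0.
have t0 : 0 < t by rewrite (lt_le_trans _ T1t)// weighted_norm_gt0.
have sD : (size D <= n)%N.
  apply/leq_sizeP => j; rewrite leq_eqVlt => /orP[/eqP <-|nj]; rewrite coefB.
    by rewrite !monic_coef// subrr.
  by rewrite !nth_default ?subrr// ?sT1 ?sT2.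
pose T := 2^-1 *: (T1 + T2).
pose q := T %% D; pose B := T %/ D.
have TE : T = B * D + q by exact: divp_eq.
have sq : (size q < size D)%N by rewrite ltn_modp.
(* The exponent 0 yields the plain supremum of [|B|]. The [e] below solves
   [(1 - e)^2 + 4 e^2 b^2 = 1 - e]. *)
pose b := weighted_norm (weight L 0) B.
pose e := (1 + 4 * b ^+ 2)^-1.
have e0 : 0 < e by rewrite invr_gt0 ltr_pwDl// mulr_ge0 ?sqr_ge0.
have e1 : e * (1 + 4 * b ^+ 2) = 1 by rewrite mulVf// gt_eqF// -invr_gt0.
have ele1 : e <= 1.
  by have := sqr_ge0 b; nra.
pose Q := T - e%:C *: q.
have [Tm sT] : T \is monic /\ size T = n.+1.
  apply: monic_size_coef.
    by rewrite (leq_trans (size_scale_leq _ _))// (leq_trans (size_polyD _ _))// sT1 sT2 maxnn.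
  by rewrite coefZ coefD !monic_coef// -(natrD _ 1 1) mulVf// pnatr_eq0.
have sqT : (size (e%:C *: q) < size T)%N.
  by rewrite sT ltnS (leq_trans (size_scale_leq _ _))// ltnW// (leq_trans sq).
have Qm : Q \is monic by rewrite monicE lead_coefDl ?size_polyN// (monicP Tm).
have sQ : size Q = n.+1 by rewrite size_polyDl ?size_polyN.
have := tmin _ Qm sQ; apply/negP; rewrite -ltNge.
apply: (@le_lt_trans _ _ (Num.sqrt (1 - e) * t)); last first.
  by rewrite gtr_pMl// -[ltRHS]sqrtr1 ltr_sqrt// gtrBl.
apply: weighted_norm_le => // z z1.
have QE : Q.[z] = (1 - e)%:C * T.[z] + e%:C * (B.[z] * D.[z]).
  have TEz : T.[z] = B.[z] * D.[z] + q.[z] by rewrite [in LHS]TE hornerD hornerM.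
  have qz : q.[z] = T.[z] - B.[z] * D.[z] by rewrite TEz addrC addKr.
  have -> : Q.[z] = T.[z] - e%:C * q.[z] by rewrite hornerD hornerN (hornerZ e%:C).
  rewrite qz.
  by rewrite rmorphB rmorph1; ring.
set W := normc (z - 1) `^ s; have W0 : 0 <= W by rewrite powR_ge0.
have hb : normc B.[z] <= b.
  by have := le_weighted_norm hL (lexx 0) B z1; rewrite powRr0 mul1r.
have h1 := le_trans (le_weighted_norm hL s0 T1 z1) T1t.
have h2 := le_trans (le_weighted_norm hL s0 T2 z1) T2t.
rewrite -/W in h1 h2.
pose y := W * normc T.[z]; pose x := W * normc D.[z].
have y0 : 0 <= y by rewrite mulr_ge0 ?normc_ge0.
have x0 : 0 <= x by rewrite mulr_ge0 ?normc_ge0.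
have xy : y ^+ 2 + x ^+ 2 / 4 <= t ^+ 2.
  have -> : y ^+ 2 + x ^+ 2 / 4 = ((W * normc T1.[z]) ^+ 2 + (W * normc T2.[z]) ^+ 2) / 2.
    have TzE : T.[z] = (T1.[z] + T2.[z]) / 2 by rewrite /T hornerZ hornerD mulrC.
    have DzE : D.[z] = T1.[z] - T2.[z] by rewrite hornerD hornerN.
    by rewrite !exprMn -[in RHS]mulrDr -[RHS]mulrA -parallelogram -TzE -DzE; ring.
  rewrite ler_pdivrMr// mulr_natr mulr2n lerD// ler_pXn2r ?nnegrE ?mulr_ge0 ?normc_ge0//; exact: ltW.
apply: (@le_trans _ _ ((1 - e) * y + e * b * x)).
  rewrite QE (le_trans (ler_wpM2l W0 (le_normcD _ _)))// mulrDr !Normc.normcM !normcR.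
  rewrite !ger0_norm ?subr_ge0 ?(ltW e0)//; apply: lerD; first by rewrite mulrCA.
  rewrite mulrCA -[leRHS]mulrA ler_wpM2l ?(ltW e0)// mulrCA ler_wpM2r// mulr_ge0 ?normc_ge0//.
have b0 : 0 <= b by exact: weighted_norm_ge0.
have e1' : 0 <= 1 - e by rewrite subr_ge0.
have l0 : 0 <= (1 - e) * y + e * b * x.
  by apply: addr_ge0; apply: mulr_ge0 => //; apply: mulr_ge0 => //; exact: ltW.
rewrite -(@ler_pXn2r _ 2) ?nnegrE//; last by rewrite mulr_ge0 ?sqrtr_ge0 ?(ltW t0).
rewrite exprMn sqr_sqrtr//; apply: (@le_trans _ _ ((1 - e) * (y ^+ 2 + x ^+ 2 / 4))); last first.
  by rewrite ler_wpM2l.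
have eE : 1 - e = (1 - e) ^+ 2 + 4 * e ^+ 2 * b ^+ 2.
  transitivity (1 - 2 * e + e * (e * (1 + 4 * b ^+ 2))); first by rewrite e1; ring.
  ring.
(* This is the Cauchy-Schwarz inequality for the vectors [(1 - e, 2 e b)] and [(y, x / 2)]. *)
rewrite [X in _ <= X * _]eE -subr_ge0.
rewrite [X in 0 <= X](_ : _ = ((1 - e) * x / 2 - 2 * e * b * y) ^+ 2); last by field.
exact: sqr_ge0.
Qed.

(** The factors are exchanged one at a time. The constant 3 bounds [|z - a|] for [z] on the circle
    and [a] in the square of [square_compact]. *)
Lemma normc_prodB_le (I : Type) (q : seq I) (f g : I -> C) (d : R) :
  (forall i, normc (f i) <= 3) -> (forall i, normc (g i) <= 3) ->
  (forall i, normc (f i - g i) <= d) ->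
  normc (\prod_(i <- q) f i - \prod_(i <- q) g i) <= (size q)%:R * 3 ^+ size q * d.
Proof.
move=> f3 g3 fgd.
have prod3 q' : normc (\prod_(i <- q') g i) <= 3 ^+ size q'.
  elim: q' => [|i q' IH]; first by rewrite big_nil Normc.normc1.
  by rewrite big_cons Normc.normcM exprS ler_pM ?normc_ge0.
elim: q => [|i q IH]; first by rewrite !big_nil subrr Normc.normc0 !mul0r.
rewrite !big_cons; set F := \prod_(_ <- _) f _ in IH *; set G := \prod_(_ <- _) g _ in IH *.
have -> : f i * F - g i * G = f i * (F - G) + (f i - g i) * G by ring.
rewrite (le_trans (le_normcD _ _))// !Normc.normcM /= -natr1 exprS.
have d0 : 0 <= d by rewrite (le_trans _ (fgd i))// normc_ge0.
apply: (@le_trans _ _ (3 * ((size q)%:R * 3 ^+ size q * d) + d * 3 ^+ size q)).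
  by apply: lerD; rewrite ler_pM ?normc_ge0// prod3.
rewrite -subr_ge0 [X in 0 <= X](_ : _ = 2 * (d * 3 ^+ size q)); last by ring.
by rewrite !mulr_ge0// exprn_ge0.
Qed.

Lemma square_compact : compact [set z : C | `|complex.Re z| <= 1 /\ `|complex.Im z| <= 1].
Proof.
pose f (u : R * R) : C := u.1 +i* u.2.
have -> : [set z : C | `|complex.Re z| <= 1 /\ `|complex.Im z| <= 1] =
    f @` (`[-1, 1]%classic `*` `[-1, 1]%classic).
  apply/seteqP; split=> [[a b] /= [a1 b1]|_ [[a b] /= [a1 b1] <-]].
    by exists (a, b) => //=; rewrite !in_itv/= -!ler_norml.
  by move: a1 b1; rewrite !in_itv/= -!ler_norml.
apply: continuous_compact; last by apply: compact_setX; exact: segment_compact.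
apply: continuous_subspaceT => u.
by apply: cvg_complex; [exact: cvg_fst|exact: cvg_snd].
Qed.

(** Reflection confines the competing roots to the disk, hence to a compact square, where the norm
    is Lipschitz in the roots and attains its minimum. As a minimiser may have roots in the corners
    of the square, it is reflected as well. *)
Lemma chebyshev_exists s n : 0 <= s ->
  exists r, [/\ size r = n, all (fun a => normc a <= 1) r &
    forall Q, Q \is monic -> size Q = n.+1 ->
      weighted_norm (weight L s) (roots_poly r) <= weighted_norm (weight L s) Q].
Proof.
move=> s0; pose N := weighted_norm (weight L s).
have reflectN r : exists r', [/\ size r' = size r, all (fun a => normc a <= 1) r' &
    N (roots_poly r') <= N (roots_poly r)].
  have [r' [sr r1 h]] := reflect_roots r; exists r'; split=> //.
  apply: weighted_norm_le => // z z1; apply: le_trans (le_weighted_norm hL s0 _ z1).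
  by rewrite ler_wpM2l ?powR_ge0// h.
pose A := [set z : C | `|complex.Re z| <= 1 /\ `|complex.Im z| <= 1].
pose K := [set v : 'rV[C]_n | forall i, A (v ord0 i)].
pose rts (v : 'rV[C]_n) := [seq v ord0 k | k <- enum 'I_n].
pose f v := N (roots_poly (rts v)).
have cK : compact K by apply: (@rV_compact C n (fun=> A)) => _; exact: square_compact.
have K0 : K !=set0 by exists 0 => i; rewrite /A/= mxE/= normr0 ler01.
have A3 z a : normc z = 1 -> A a -> normc (z - a) <= 3.
  move=> z1 [a1 a2]; rewrite (le_trans (le_normcD _ _))// normcN z1.
  by have := normc_le a; lra.
pose c := 2 `^ s * (n%:R * 3 ^+ n) : R.
have c0 : 0 <= c by rewrite !mulr_ge0 ?powR_ge0 ?exprn_ge0.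
have fle u v d : K u -> K v -> (forall i, normc (u ord0 i - v ord0 i) <= d) -> f u <= f v + c * d.
  move=> Ku Kv uvd; apply: weighted_norm_le => // z z1.
  have := le_weighted_norm hL s0 (roots_poly (rts v)) z1; rewrite -/(N _) -/(f v) => hv.
  set W := _ `^ s in hv *; have W0 : 0 <= W by rewrite powR_ge0.
  have W2 : W <= 2 `^ s.
    rewrite ge0_ler_powR ?nnegrE ?normc_ge0// (le_trans (le_normcD _ _))//.
    by rewrite normcN z1 Normc.normc1.
  have hd : normc ((roots_poly (rts u)).[z] - (roots_poly (rts v)).[z]) <= n%:R * 3 ^+ n * d.
    rewrite /roots_poly !horner_prod !big_map.
    under eq_bigr do rewrite hornerXsubC; under [X in _ - X]eq_bigr do rewrite hornerXsubC.
    have := @normc_prodB_le _ (enum 'I_n) (fun i => z - u ord0 i) (fun i => z - v ord0 i) d.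
    rewrite size_enum_ord enumT; apply=> i.
    - exact: A3.
    - exact: A3.
    - by rewrite opprB addrC addrA subrK -normcN opprB.
  have := le_normcD ((roots_poly (rts u)).[z] - (roots_poly (rts v)).[z]) (roots_poly (rts v)).[z].
  rewrite subrK => /(ler_wpM2l W0) /le_trans; apply; rewrite mulrDr addrC lerD//.
  by rewrite /c -mulrA ler_pM ?normc_ge0.
have cf : {within K, continuous f}.
  apply/subspace_continuousP => u Ku; apply/cvgrPdist_lt => e e0.
  (* Adding 1 avoids a division by 0, as [c] is 0 for [n = 0]. *)
  pose d := e / (c + 1).
  have d0 : 0 < d by rewrite divr_gt0// ltr_wpDl.
  have cd : c * d < e by rewrite /d mulrA ltr_pdivrMr ?ltr_wpDl// mulrC ltr_pM2l// ltrDl.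
  suff: nbhs u (fun v => K v -> `|f u - f v| < e) by [].
  have : nbhs u (fun v => forall i, normc (u ord0 i - v ord0 i) < d).
    apply/nbhs_ballP; exists d%:C; first by rewrite /= ltcR.
    move=> v [_ uv] i; have := uv ord0 i.
    by rewrite -ball_normE/= normCE ltcR.
  apply: filterS => v uvd Kv; rewrite (le_lt_trans _ cd)// ler_norml.
  have h1 := fle u v d Ku Kv (fun i => ltW (uvd i)).
  have h2 := fle v u d Kv Ku (fun i => ltac:(by rewrite -normcN opprB ltW)).
  by apply/andP; split; lra.
have [v /[!inE] Kv vmin] := compact_EVT_min K0 cK cf.
have [r [sr r1 rv]] := reflectN (rts v).
exists r; split=> //; first by rewrite sr size_map size_enum_ord.
move=> Q Qm sQ; have [q sq ->] := monic_roots_poly Qm.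
have [q' [sq' q1 hq]] := reflectN q.
apply: le_trans rv (le_trans _ hq).
have nq' : size q' = n by apply/eqP; rewrite sq' -eqSS sq sQ.
pose u : 'rV[C]_n := \row_k nth 0 q' k.
have -> : roots_poly q' = roots_poly (rts u).
  congr roots_poly; apply: (@eq_from_nth _ 0); first by rewrite size_map size_enum_ord.
  move=> i iq; rewrite nq' in iq; rewrite (nth_map (Ordinal iq)) ?size_enum_ord// mxE.
  by rewrite nth_enum_ord.
apply: vmin; rewrite inE => i; rewrite mxE.
have /(allP q1) a1 : nth 0 q' i \in q' by rewrite mem_nth// nq'.
by split; apply: le_trans a1; [exact: abs_Re_le|exact: abs_Im_le].
Qed.

End Weight.
End Chebyshev.

(** * The two extremal problems *)

Section Lax.
Variable R : realType.
Local Notation C := R[i].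
Local Notation normc := (@Normc.normc R).
Implicit Types (z w a : C) (x y s t : R) (r : seq C) (n : nat) (P Q T D : {poly C}).

(** On coefficients the map is triangular with diagonal entries [s + m + 1]; monicity and
    injectivity follow from this. *)
Lemma coef_lax s P m : ((s + 1)%:C *: P + ('X - 1) * P^`())`_m =
  (s + m%:R + 1)%:C * P`_m - P`_m.+1 *+ m.+1.
Proof.
rewrite coefD coefZ mulrBl mul1r coefB coefXM !coef_deriv.
have -> : (s + m%:R + 1)%:C = (s + 1)%:C + m%:R :> C.
  by rewrite -(rmorph_nat (real_complex R)) -rmorphD/= addrAC.
case: m => [|m] /=; first by rewrite sub0r addr0.
by rewrite addrA mulrDl mulr_natl.
Qed.

Lemma lax_scalar_neq0 s m : 0 <= s -> (s + m%:R + 1)%:C != 0 :> C.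
Proof.
move=> s0; rewrite -[0]/(0%:C) (inj_eq (@complexI R)) gt_eqF// ltr_wpDl// addr_ge0//.
Qed.

Lemma lax_poly_monic s n P : 0 <= s -> P \is monic -> size P = n.+1 ->
  lax_poly s n P \is monic /\ size (lax_poly s n P) = n.+1.
Proof.
move=> s0 Pm sP; apply: monic_size_coef.
  apply: leq_trans (size_scale_leq _ _) _; apply/leq_sizeP => m nm.
  by rewrite coef_lax !nth_default ?sP ?leqW// mulr0 mul0rn subr0.
rewrite coefZ coef_lax (monic_coef Pm sP) mulr1 nth_default ?sP// mul0rn subr0.
by rewrite mulVf// lax_scalar_neq0.
Qed.

(** The top coefficient of [P - Q] is only multiplied by nonzero numbers, as no higher coefficient
    interferes. *)
Lemma lax_poly_inj s n P Q : 0 <= s -> lax_poly s n P = lax_poly s n Q -> P = Q.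
Proof.
move=> s0 PQ; apply/eqP; rewrite -subr_eq0; apply/negPn/negP => D0.
have := lead_coef_eq0 (P - Q); rewrite (negbTE D0) lead_coefE => /negP; apply.
set m := (size (P - Q)).-1.
have : (lax_poly s n P - lax_poly s n Q)`_m = 0 by rewrite PQ subrr coef0.
have e : P`_m.+1 = Q`_m.+1.
  by apply/eqP; rewrite -subr_eq0 -coefB nth_default// /m leqSpred.
rewrite /lax_poly -scalerBr coefZ coefB !coef_lax e opprB addrA subrK -mulrBr -coefB => /eqP.
by rewrite !mulf_eq0 invr_eq0 !(negbTE (lax_scalar_neq0 _ s0)).
Qed.

Section Weight.
Variable L : C -> C.
Hypothesis hL : log_branch L.

(** Monic complex polynomials split, so minimising over roots amounts to minimising over all monic
    polynomials of degree [n]. *)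
Lemma is_chebyshevP s n T : is_chebyshev (weight L s) n T <->
  [/\ T \is monic, size T = n.+1 & forall Q, Q \is monic -> size Q = n.+1 ->
    weighted_norm (weight L s) T <= weighted_norm (weight L s) Q].
Proof.
have image Q : Q \is monic -> size Q = n.+1 ->
    [set weighted_norm (weight L s) (poly_of_roots a) | a in [set: 'I_n -> C]]
      (weighted_norm (weight L s) Q).
  move=> Qm sQ; have [r sr ->] := monic_roots_poly Qm.
  have {sr} -> : n = size r by apply/eqP; rewrite -eqSS sr sQ.
  by exists (fun k => nth 0 r k); rewrite // seq_poly_of_roots.
split=> [[Tm sT [_ Tmin]]|[Tm sT Tmin]]; split=> //.
  by move=> Q Qm sQ; apply: Tmin; exact: image.
split; first exact: image.
move=> _ [a _ <-]; rewrite poly_of_roots_seq; apply: Tmin; first exact: roots_poly_monic.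
by rewrite size_roots_poly size_map size_enum_ord.
Qed.

Lemma chebyshev_polyE s n T : 0 <= s -> is_chebyshev (weight L s) n T ->
  chebyshev_poly (weight L s) n = T.
Proof.
move=> s0 Tch; have [Tm sT Tmin] := (is_chebyshevP s n T).1 Tch.
have uniq Q : is_chebyshev (weight L s) n Q -> T = Q.
  move=> /is_chebyshevP[Qm sQ Qmin].
  by apply: (@chebyshev_unique _ _ hL s n (weighted_norm (weight L s) T)) => //; exact: Qmin.
rewrite /chebyshev_poly; have : unique (is_chebyshev (weight L s) n) T by [].
by move=> /(@xgetI _ (0 : {poly C}) [set T | unique (is_chebyshev (weight L s) n) T])[/uniq <-].
Qed.

(* The two extremal problems bound each other through [P |-> lax_poly s n P] and [circle_companion]. *)
Lemma restricted_minimiserP s n : 0 <= s -> exists T P,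
  [/\ is_chebyshev (weight L s) n T,
    restricted_minimiser (weight L (s + 1)) n P &
    forall Q, restricted_minimiser (weight L (s + 1)) n Q ->
      lax_poly s n Q = T /\
      weighted_norm (weight L s) T = 2^-1 * weighted_norm (weight L (s + 1)) Q].
Proof.
move=> s0; have s10 : 0 <= s + 1 by rewrite addr_ge0.
have [q [sq q1 Tmin]] := chebyshev_exists hL n s0.
have [r [sr r1 hr]] := circle_companion q1.
set T := roots_poly q in Tmin hr; set P := roots_poly r in hr.
have Tm : T \is monic by exact: roots_poly_monic.
have sT : size T = n.+1 by rewrite size_roots_poly sq.
(* One unit of the exponent [s + 1] is spent on the bound of [circle_companion]. *)
have PT : weighted_norm (weight L (s + 1)) P <= 2 * weighted_norm (weight L s) T.
  apply: weighted_norm_le => // z z1; have := le_weighted_norm hL s0 T z1.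
  rewrite -(ler_pM2l (ltr0n _ 2)) => /(le_trans _); apply.
  rewrite powRD; last by rewrite gt_eqF// ltr_wpDl.
  rewrite powRr1 ?normc_ge0// -mulrA [leRHS]mulrCA ler_wpM2l ?powR_ge0//.
  exact: hr.
(* Together with [PT], this chain shows that [P] is minimal, and that for a minimiser all the
   inequalities are equalities. *)
have low r' : size r' = n -> all (fun a => normc a == 1) r' ->
    let Q := roots_poly r' in
    weighted_norm (weight L s) T <= weighted_norm (weight L s) (lax_poly s n Q) /\
    weighted_norm (weight L s) (lax_poly s n Q) <= 2^-1 * weighted_norm (weight L (s + 1)) Q.
  move=> sr' r'1 Q; split; last by rewrite -sr'; exact: weighted_norm_lax_poly.
  have [||m sz] := @lax_poly_monic s n Q s0; first exact: roots_poly_monic.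
    by rewrite size_roots_poly sr'.
  exact: Tmin.
have minP : restricted_minimiser (weight L (s + 1)) n P.
  have aP : exists2 alpha, @angles R n alpha & P = circle_poly alpha.
    by apply/circle_polyP; exists r; rewrite sr sq.
  split=> //; split.
    by have [al h ->] := aP; exists al.
  move=> _ [al h <-].
  have /circle_polyP[r' [sr' r'1 ->]] : exists2 alpha, @angles R n alpha & circle_poly al = circle_poly alpha.
    by exists al.
  by have [h1 h2] := low _ sr' r'1; rewrite /= in h1 h2; lra.
exists T, P; split=> //; first by apply/is_chebyshevP.
move=> Q [/circle_polyP[r' [sr' r'1 ->]] [_ Qmin]].
have [h1 h2] := low _ sr' r'1; rewrite /= in h1 h2.
have QP : weighted_norm (weight L (s + 1)) (roots_poly r') <= weighted_norm (weight L (s + 1)) P.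
  by apply: Qmin; have [_ []] := minP.
have [||m sz] := @lax_poly_monic s n (roots_poly r') s0; first exact: roots_poly_monic.
  by rewrite size_roots_poly sr'.
split; last by lra.
apply: (@chebyshev_unique _ _ hL s n (weighted_norm (weight L s) T)) => //; lra.
Qed.

End Weight.
End Lax.

Theorem theorem1 (R : realType) (L : R[i] -> R[i]) (hL : log_branch L) :
  (forall (n : nat) (s : R) (P : {poly R[i]}),
     (0 < n)%N -> 0 <= s ->
     restricted_minimiser (weight L (s + 1)) n P ->
     let T := chebyshev_poly (weight L s) n in
     let F := fun z : R[i] => weight L (s + 1) z * P.[z] in
     (forall z : R[i], unit_disk z ->
        derivable F z 1 /\
        ((s + n%:R + 1)%:C)^-1 * 'D_1 F z = weight L s z * T.[z]) /\
     weighted_norm (weight L s) T = 2^-1 * weighted_norm (weight L (s + 1)) P) /\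
  (forall (n : nat) (s : R),
     (0 < n)%N -> 1 <= s ->
     exists! P : {poly R[i]}, restricted_minimiser (weight L s) n P).
Proof.
split=> [n s P _ s0 minP T F|n s _ s1].
  have [T0 [_ [T0ch _ /(_ _ minP)[T0E wE]]]] := restricted_minimiserP hL n s0.
  rewrite {}/T (chebyshev_polyE hL s0 T0ch); split=> // z z1.
  have [dF DF] := is_derive_weight_poly s P hL z1; split; first exact: dF.
  by rewrite -T0E DF /lax_poly hornerZ mulrCA.
(* The first part applies with parameter [s - 1]: two minimisers have the same image under
   [lax_poly], hence coincide. *)
have s0 : 0 <= s - 1 by rewrite subr_ge0.
have [T [P [_ minP h]]] := restricted_minimiserP hL n s0.
rewrite subrK in minP h; exists P; split=> // Q minQ.
apply: (lax_poly_inj s0 (n := n)).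
by rewrite (h _ minP).1 (h _ minQ).1.
Qed.
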